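(* Let $n_1 = 5(2^1-1)+18\cdot 2^1 = 41$ and let $\widetilde{\omega} = (3,3,2,1,1)$, a weight vector of degree $41$. Let $(\widetilde{Sq}^0_* )_{(5,41)} : Q^{\otimes 5}_{41}\to Q^{\otimes 5}_{18}$ be the Kameko homomorphism. Then there is an isomorphism of $\mathbb F_2$-vector spaces $$\mathrm{Ker}\,(\widetilde{Sq}^0_* )_{(5,41)} \;\cong\; (Q^{\otimes 5}_{41})^0 \;\oplus\; (Q^{\otimes 5}_{41})^{\widetilde{\omega}^{>0}}.$$
   Context: Let $\mathscr A$ be the mod 2 Steenrod algebra, $\overline{\mathscr A}$ its positive degree part, and $\mathcal P_m=\mathbb F_2[x_1,\dots,x_m]$ with $\deg x_i=1$, viewed as an $\mathscr A$-module via $Sq^0(x_i)=x_i$, $Sq^1(x_i)=x_i^2$, $Sq^j(x_i)=0$ for $j>1$, and the Cartan formula. Put $Q^{\otimes m}=\mathbb F_2\otimes_{\mathscr A}\mathcal P_m=\mathcal P_m/\overline{\mathscr A}\mathcal P_m$ and let $Q^{\otimes m}_n$ be its degree $n$ part. The class of $f$ in $Q^{\otimes m}$ is denoted $[f]$. Kameko homomorphism: $(\widetilde{Sq}^0_* )_{(m,m+2n)}: Q^{\otimes m}_{m+2n}\to Q^{\otimes m}_n$ is the well-defined linear map sending $[x_1^{a_1}\cdots x_m^{a_m}]$ to $[x_1^{(a_1-1)/2}\cdots x_m^{(a_m-1)/2}]$ if all $a_j$ are odd, and to $0$ otherwise. $\mathcal P_m^0$ (resp. $\mathcal P_m^{>0}$)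 is the $\mathscr A$-submodule of $\mathcal P_m$ spanned by the monomials $\prod_j x_j^{t_j}$ with $\prod_j t_j=0$ (resp. $\prod_j t_j>0$). Put $(Q^{\otimes m})^0=\mathbb F_2\otimes_{\mathscr A}\mathcal P_m^0$, $(Q^{\otimes m})^{>0}=\mathbb F_2\otimes_{\mathscr A}\mathcal P_m^{>0}$, so that $Q^{\otimes m}=(Q^{\otimes m})^0\oplus (Q^{\otimes m})^{>0}$; a subscript $n$ denotes the degree $n$ part. A weight vector is a sequence $\omega=(\omega_1,\omega_2,\dots)$ of non-negative integers with $\omega_t=0$ for $t\gg0$ (trailing zeros are omitted); its degree is $\deg\omega=\sum_{t\ge1}2^{t-1}\omega_t$. For a monomial $X=x_1^{u_1}\cdots x_m^{u_m}$, its weight vector $\omega(X)$ has $\omega_t(X)=\sum_{j}\alpha_{t-1}(u_j)$, where $\alpha_s(u)$ is the coefficient of $2^s$ in the binary expansion of $u$. Weight vectors are ordered left-lexicographically. Let $\mathcal P_m^{\le\omega}$ (resp. $\mathcal P_m^{<\omega}$) be the span of the monomials $X$ with $\deg X=\deg\omega$ and $\omega(X)\le\omega$ (resp. $\omega(X)<\omega$), and put $$(Q^{\otimes m})^\omega=\mathcal P_m^{\le\omega}/\big((\overline{\mathscr A}\mathcal P_m\cap\mathcal P_m^{\le\omega})+\mathcal P_m^{<\omega}\big).$$ For $\deg\omega=n$, $(Q^{\otimes m}_n)^{\omega^{>0}}$ denotes the subspace of $(Q^{\otimes m})^{\omega}$ spanned by the classes of monomials in $\mathcal P_m^{\le\omega}\cap\mathcal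 P_m^{>0}$. *)

(* Defs.v *)
From HB Require Import structures.
From mathcomp Require Import all_boot all_order all_algebra.
From mathcomp Require Import boolp.
From mathcomp Require Import ssrcomplements mpoly.

Set Implicit Arguments.
Unset Strict Implicit.
Unset Printing Implicit Defensive.

Import GRing.Theory.
Local Open Scope ring_scope.
Local Open Scope quotient_scope.

Section Submodules.
Variables (R : nzRingType) (V : lmodType R).

Definition lspan (S : V -> Prop) : {pred V} := fun f =>
  `[< exists k (c : 'I_k -> R) (v : 'I_k -> V),
        (forall i, S (v i)) /\ f = \sum_(i < k) c i *: v i >].

Lemma lspan_submod_closed S : submod_closed (lspan S).
Proof.
split.
  apply/asboolP; exists 0%N, (fun=> 0), (fun=> 0); split; first by case.
  by rewrite big_ord0.
move=> a f g /asboolP[k [c [v [Sv ->]]]] /asboolP[l [d [w [Sw ->]]]].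
apply/asboolP; exists (k + l)%N.
exists (fun i => match split i with inl j => a * c j | inr j => d j end).
exists (fun i => match split i with inl j => v j | inr j => w j end).
split; first by move=> i; case: (split i).
rewrite big_split_ord scaler_sumr /=; congr (_ + _); apply: eq_bigr => i _.
  by case: splitP => j /= ij; [rewrite (val_inj ij) scalerA |
    have := ltn_ord i; rewrite ij ltnNge leq_addr].
case: splitP => j /= ij; first by have := ltn_ord j; rewrite -ij ltnNge leq_addr.
by move: ij => /addnI/val_inj ->.
Qed.

HB.instance Definition _ S :=
  GRing.isSubmodClosed.Build R V (lspan S) (lspan_submod_closed S).

Lemma lspan_gen (S : V -> Prop) f : S f -> f \in lspan S.
Proof.
move=> Sf; apply/asboolP; exists 1%N, (fun=> 1), (fun=> f).
by rewrite big_ord1 scale1r.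
Qed.

Lemma lspan_min (S : V -> Prop) (A : submodClosed V) :
  (forall f, S f -> f \in A) -> {subset lspan S <= A}.
Proof.
move=> SA f /asboolP[k [c [v [Sv ->]]]].
by apply: rpred_sum => i _; apply: rpredZ; apply: SA.
Qed.

Definition capsm (A B : submodClosed V) : {pred V} :=
  fun f => (f \in A) && (f \in B).

Lemma capsm_submod_closed A B : submod_closed (capsm A B).
Proof.
split; first by apply/andP; rewrite !rpred0.
move=> a f g /andP[fA fB] /andP[gA gB]; apply/andP.
by rewrite !rpredD ?rpredZ.
Qed.

HB.instance Definition _ A B :=
  GRing.isSubmodClosed.Build R V (capsm A B) (capsm_submod_closed A B).

Definition addsm (A B : submodClosed V) : {pred V} := fun f =>
  `[< exists g h, [/\ g \in A, h \in B & f = g + h] >].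

Lemma addsm_submod_closed A B : submod_closed (addsm A B).
Proof.
split; first by apply/asboolP; exists 0, 0; rewrite !rpred0 addr0.
move=> a _ _ /asboolP[f [g [fA gB ->]]] /asboolP[f' [g' [fA' gB' ->]]].
apply/asboolP; exists (a *: f + f'), (a *: g + g').
by split; rewrite ?rpredD ?rpredZ // scalerDr addrACA.
Qed.

HB.instance Definition _ A B :=
  GRing.isSubmodClosed.Build R V (addsm A B) (addsm_submod_closed A B).

Definition submodule (A : submodClosed V) : Type := {f : V | f \in A}.

HB.instance Definition _ A := SubChoice.on (submodule A).
HB.instance Definition _ A :=
  [SubChoice_isSubLmodule of submodule A by <:].

(* submodClosed does not inherit from zmodClosed, which Quotient.quot needs *)
Definition zmod_of (B : submodClosed V) : {pred V} := fun f => f \in B.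

Lemma zmod_of_zmod_closed B : zmod_closed (zmod_of B).
Proof.
split; first exact: rpred0.
by move=> f g fB gB; rewrite unfold_in -scaleN1r addrC rpredD ?rpredZ.
Qed.

HB.instance Definition _ B :=
  GRing.isZmodClosed.Build V (zmod_of B) (zmod_of_zmod_closed B).

Definition quotmod (B : submodClosed V) : Type := Quotient.quot (zmod_of B).

HB.instance Definition _ B := GRing.Zmodule.on (quotmod B).

Variable B : submodClosed V.

Definition cls (f : V) : quotmod B := \pi_(Quotient.quot (zmod_of B)) f.

Lemma cls_eq f g : (cls f = cls g) <-> (f - g \in B).
Proof.
have -> : (f - g \in B) = (cls f == cls g).
  exact: (Quotient.idealrBE (zmod_of B) f g).
by split => /eqP.
Qed.

Lemma clsK (q : quotmod B) : cls (repr q) = q.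
Proof. exact: reprK. Qed.

Lemma cls_zmod_morphism : zmod_morphism cls.
Proof. by move=> f g; rewrite /cls raddfB. Qed.

HB.instance Definition _ :=
  GRing.isZmodMorphism.Build V (quotmod B) cls cls_zmod_morphism.

Definition quot_scale (a : R) (q : quotmod B) : quotmod B := cls (a *: repr q).

Lemma quot_scaleE a f : quot_scale a (cls f) = cls (a *: f).
Proof.
by apply/cls_eq; rewrite -scalerBr rpredZ //; apply/cls_eq; rewrite clsK.
Qed.

Fact quot_scaleA a b q :
  quot_scale a (quot_scale b q) = quot_scale (a * b) q.
Proof. by rewrite -[q]clsK !quot_scaleE scalerA. Qed.

Fact quot_scale1 : left_id 1 quot_scale.
Proof. by move=> q; rewrite -[q]clsK quot_scaleE scale1r. Qed.

Fact quot_scaleDr : right_distributive quot_scale +%R.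
Proof.
move=> a p q; rewrite -[p]clsK -[q]clsK -raddfD !quot_scaleE -raddfD.
by rewrite scalerDr.
Qed.

Fact quot_scaleDl q : {morph quot_scale^~ q : a b / a + b}.
Proof. by move=> a b; rewrite -[q]clsK !quot_scaleE -raddfD scalerDl. Qed.

HB.instance Definition _ := GRing.Zmodule_isLmodule.Build R (quotmod B)
  quot_scaleA quot_scale1 quot_scaleDr quot_scaleDl.

Lemma cls_scalable : scalable cls.
Proof. by move=> a f; rewrite -quot_scaleE. Qed.

HB.instance Definition _ :=
  GRing.isScalable.Build R V (quotmod B) *:%R cls cls_scalable.

(* The image of A in V / B: it is A / B when B is contained in A, and the
   degree n part of a graded quotient when A consists of degree n elements. *)
Definition subquot (A : submodClosed V) : {pred quotmod B} :=
  fun q => `[< exists2 f, f \in A & q = cls f >].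

Lemma subquot_submod_closed A : submod_closed (subquot A).
Proof.
split; first by apply/asboolP; exists 0; [exact: rpred0 | rewrite raddf0].
move=> a _ _ /asboolP[f fA ->] /asboolP[g gA ->].
by apply/asboolP; exists (a *: f + g); rewrite ?linearP // rpredD ?rpredZ.
Qed.

HB.instance Definition _ A :=
  GRing.isSubmodClosed.Build R (quotmod B) (subquot A)
    (subquot_submod_closed A).

Lemma subquot_cls (A : submodClosed V) f : f \in A -> cls f \in subquot A.
Proof. by move=> fA; apply/asboolP; exists f. Qed.

End Submodules.

Arguments cls {R V} B f : simpl never.
Arguments subquot {R V} B A q : simpl never.

Definition kernel (R : nzRingType) (V W : lmodType R) (f : {linear V -> W}) :
  {pred V} := fun x => f x == 0.

Lemma kernel_submod_closed (R : nzRingType) (V W : lmodType R)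
  (f : {linear V -> W}) : submod_closed (kernel f).
Proof.
split; first by rewrite unfold_in raddf0.
move=> a x y; rewrite !unfold_in => /eqP fx /eqP fy.
by rewrite linearP fx fy scaler0 addr0.
Qed.

HB.instance Definition _ (R : nzRingType) (V W : lmodType R)
  (f : {linear V -> W}) :=
  GRing.isSubmodClosed.Build R V (kernel f) (kernel_submod_closed f).

Definition lmod_iso (R : nzRingType) (V W : lmodType R) : Prop :=
  exists f : {linear V -> W}, bijective f.

Lemma coef_sqr_pchar2 (R : comNzRingType) (p : {poly R}) k :
  2%N \in [pchar R] -> (p ^+ 2)`_k = if odd k then 0 else p`_(k./2) ^+ 2.
Proof.
move=> R2; elim/poly_ind: p k => [|p c IH] k.
  by rewrite expr0n /= !coef0 expr0n if_same.
have -> : (p * 'X + c%:P) ^+ 2 = p ^+ 2 * 'X * 'X + (c ^+ 2)%:P.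
  rewrite sqrrD exprMn -mulrA -expr2 polyC_exp mulrn_pchar ?addr0 //.
  by rewrite pchar_poly.
rewrite !(coefD, coefMX, coefC).
case: k => [|[|k]] /=; rewrite ?add0r ?addr0 ?mulr0 ?expr0n //.
by rewrite IH negbK.
Qed.

Definition F2 : fieldType := 'F_2.

Lemma pchar2_F2 : 2%N \in [pchar F2].
Proof. exact: pchar_Fp. Qed.

Lemma F2_sqr (c : F2) : c ^+ 2 = c.
Proof. by case: c => [[|[|?]] ?] //; apply/val_inj. Qed.

Section Steenrod.
Variable m : nat.
Local Notation P := {mpoly F2[m]}.

(* The Cartan formula says that the total square f |-> \sum_k Sq^k(f) t^k is
   multiplicative, so it is the ring morphism P -> P[t] that sends each
   variable x to x + x^2 t; Sq k is its t^k coefficient. See Sq_gen0, Sq_gen1,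
   Sq_gen_gt1 and Sq_cartan. *)
Definition total_Sq (f : P) : {poly P} :=
  mmap (polyC \o mpolyC m (R := F2))
       (fun i => ('X_i)%:P + ('X_i ^+ 2)%:P * 'X) f.

Lemma total_Sq_zmod_morphism : zmod_morphism total_Sq.
Proof. by move=> f g; rewrite /total_Sq raddfB. Qed.

HB.instance Definition _ :=
  GRing.isZmodMorphism.Build P {poly P} total_Sq total_Sq_zmod_morphism.

Lemma total_Sq_monoid_morphism : monoid_morphism total_Sq.
Proof. by split=> [|f g]; rewrite /total_Sq ?rmorph1 ?rmorphM. Qed.

HB.instance Definition _ :=
  GRing.isMonoidMorphism.Build P {poly P} total_Sq total_Sq_monoid_morphism.

Lemma total_SqC c : total_Sq c%:MP = (c%:MP)%:P.
Proof. by rewrite /total_Sq mmapC. Qed.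

Lemma total_Sq_var i : total_Sq 'X_i = ('X_i)%:P + ('X_i ^+ 2)%:P * 'X.
Proof. by rewrite /total_Sq mmapX mmap1U. Qed.

Definition Sq (k : nat) (f : P) : P := (total_Sq f)`_k.

Lemma Sq_linear k : linear (Sq k).
Proof.
move=> a f g; rewrite /Sq raddfD coefD /=; congr (_ + _).
by rewrite -mul_mpolyC rmorphM /= total_SqC coefCM mul_mpolyC.
Qed.

HB.instance Definition _ k :=
  GRing.isLinear.Build F2 P P _ (Sq k) (Sq_linear k).

Lemma SqZ k a f : Sq k (a *: f) = a *: Sq k f.
Proof. exact: linearZ. Qed.

Lemma Sq_gen0 i : Sq 0 'X_i = 'X_i.
Proof. by rewrite /Sq total_Sq_var coefD coefC coefMX addr0. Qed.

Lemma Sq_gen1 i : Sq 1 'X_i = 'X_i ^+ 2.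
Proof. by rewrite /Sq total_Sq_var coefD coefC coefMX coefC add0r. Qed.

Lemma Sq_gen_gt1 k i : (1 < k)%N -> Sq k 'X_i = 0.
Proof.
by case: k => [|[|k]] // _; rewrite /Sq total_Sq_var coefD coefC coefMX coefC addr0.
Qed.

Lemma Sq_const k : Sq k 1 = (k == 0%N)%:R.
Proof. by rewrite /Sq rmorph1 coef1. Qed.

Lemma Sq_cartan k f g :
  Sq k (f * g) = \sum_(i < k.+1) Sq i f * Sq (k - i) g.
Proof. by rewrite /Sq rmorphM coefM. Qed.

(* The word [:: k_1; ...; k_r] stands for Sq^{k_1} ... Sq^{k_r}. *)
Definition Sq_word (I : seq nat) (f : P) : P := foldr Sq f I.

(* The words span the Steenrod algebra and those of positive total degree span
   its positive degree part. *)
Definition Abar (M : {pred P}) : {pred P} :=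
  lspan (fun g => exists I f, [/\ (0 < sumn I)%N, f \in M & g = Sq_word I f]).

HB.instance Definition _ M := GRing.SubmodClosed.on (Abar M).

Definition hit : {pred P} := Abar predT.

HB.instance Definition _ := GRing.SubmodClosed.on hit.

Definition homdeg (n : nat) : {pred P} := fun f => f \is n.-homog.

Lemma homdeg_submod_closed n : submod_closed (homdeg n).
Proof. exact: dhomog_submod_closed. Qed.

HB.instance Definition _ n :=
  GRing.isSubmodClosed.Build F2 P (homdeg n) (homdeg_submod_closed n).

Definition P0 : {pred P} :=
  lspan (fun f => exists2 u : 'X_{1..m}, (\prod_j u j = 0)%N & f = 'X_[u]).
Definition Ppos : {pred P} :=
  lspan (fun f => exists2 u : 'X_{1..m}, (0 < \prod_j u j)%N & f = 'X_[u]).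

HB.instance Definition _ := GRing.SubmodClosed.on P0.
HB.instance Definition _ := GRing.SubmodClosed.on Ppos.

Definition Qdeg (n : nat) := submodule (subquot hit (homdeg n)).

Definition Q0deg (n : nat) :=
  submodule (subquot (Abar P0) (capsm P0 (homdeg n))).

Definition kameko_half (u : 'X_{1..m}) : 'X_{1..m} :=
  [multinom (u j).-1./2 | j < m].

Definition kameko_mon (u : 'X_{1..m}) : P :=
  if [forall j, odd (u j)] then 'X_[kameko_half u] else 0.

(* kameko is induced by this map on polynomials: kameko_poly_hit gives that it
   is well defined, kameko_monE its value on monomial classes. *)
Definition kameko_poly (f : P) : P :=
  \sum_(u <- msupp f) f@_u *: kameko_mon u.

Lemma kameko_polyE k f : (msize f <= k)%N ->
  kameko_poly f = \sum_(u : 'X_{1..m < k}) f@_u *: kameko_mon u.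
Proof.
move=> le_fk; set I : subFinType _ := 'X_{1..m < k}.
rewrite /kameko_poly (big_mksub I) ?msupp_uniq //=; first last.
  by move=> x /msize_mdeg_lt /leq_trans; apply.
by rewrite big_rmcond //= => j /memN_msupp_eq0 ->; rewrite scale0r.
Qed.

Lemma kameko_poly_linear : linear kameko_poly.
Proof.
move=> a f g; set k := maxn (msize (a *: f + g)) (maxn (msize f) (msize g)).
rewrite !(@kameko_polyE k) ?leq_max ?leqnn ?orbT // scaler_sumr -big_split /=.
by apply: eq_bigr => u _; rewrite linearP scalerDl scalerA.
Qed.

HB.instance Definition _ :=
  GRing.isLinear.Build F2 P P _ kameko_poly kameko_poly_linear.

Lemma kameko_polyZ a f : kameko_poly (a *: f) = a *: kameko_poly f.
Proof. exact: linearZ. Qed.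

Lemma kameko_polyX u : kameko_poly 'X_[u] = kameko_mon u.
Proof. by rewrite /kameko_poly msuppX big_seq1 mcoeffX eqxx scale1r. Qed.

Lemma pchar2_mpoly : 2%N \in [pchar P].
Proof.
by apply/andP; split; rewrite // -mpolyC1 -rmorphMn (pcharf0 pchar2_F2) raddf0.
Qed.

Lemma kameko_poly_sqrM g f : kameko_poly (g ^+ 2 * f) = g * kameko_poly f.
Proof.
rewrite [g]mpolyE; elim: (msupp g) => [|v s IH].
  by rewrite big_nil expr0n /= !mul0r raddf0.
rewrite big_cons; set h := \sum_(u <- s) _ in IH *.
have sqD (a b : P) : (a + b) ^+ 2 = a ^+ 2 + b ^+ 2.
  by rewrite sqrrD mulrn_pchar ?pchar2_mpoly ?addr0.
rewrite sqD !mulrDl raddfD /= IH; congr (_ + _).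
rewrite exprZn F2_sqr -!scalerAl linearZ /=; congr (_ *: _).
rewrite {1}[f]mpolyE mulr_sumr raddf_sum /kameko_poly mulr_sumr.
apply: eq_bigr => u _ /=; rewrite -!scalerAr linearZ /=; congr (_ *: _).
rewrite mpolyXn -mpolyXD -/(kameko_poly _) kameko_polyX /kameko_mon.
have E j : (v *+ 2 + u)%MM j = ((v j).*2 + u j)%N.
  by rewrite mnmDE mulmnE muln2.
rewrite (eq_forallb (P2 := fun j => odd (u j))); last first.
  by move=> j; rewrite E oddD odd_double.
case: forallP => [uodd|_]; last by rewrite mulr0.
rewrite -mpolyXD; congr 'X_[_]; apply/mnmP => j.
rewrite mnmDE ![kameko_half _ j]mnmE E.
have := uodd j; case: (u j) => //= k _.
by rewrite addnS /= halfD odd_double doubleK.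
Qed.

Lemma kameko_Sq_squarefree (e : 'X_{1..m}) k : (forall j, e j <= 1)%N ->
  kameko_poly (Sq k 'X_[e]) = ([forall j, odd (e j)] && (k == 0%N))%:R.
Proof.
move=> e1; pose a j : P := if odd (e j) then 'X_j ^+ 2 else 0.
pose b j : P := if odd (e j) then 'X_j else 1.
have -> : Sq k 'X_[e] =
    \sum_(J : {set 'I_m} | #|J| == k) \prod_j (if j \in J then a j else b j).
  rewrite /Sq mpolyXE_id rmorph_prod.
  rewrite (eq_bigr (fun j => (a j)%:P * 'X + (b j)%:P)) => [|j _]; last first.
    rewrite rmorphXn /= total_Sq_var /a /b.
    case: (e j) (e1 j) => [|[|]] //= _; first by rewrite mul0r add0r expr0.
    by rewrite addrC expr1.
  rewrite bigA_distr coef_sum big_mkcond /= [RHS]big_mkcond /=.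
  apply: eq_bigr => J _.
  rewrite (eq_bigr (fun j => (if j \in J then a j else b j)%:P *
                             (if j \in J then 'X else 1))); last first.
    by move=> j _; case: ifP; rewrite ?mulr1.
  rewrite big_split /= -rmorph_prod coefCM -big_mkcond prodr_const coefXn.
  by rewrite eq_sym; case: eqP => _; rewrite ?mulr1 ?mulr0.
pose w (J : {set 'I_m}) : 'X_{1..m} := [multinom if j \in J then 2 else e j | j < m].
have kamJ (J : {set 'I_m}) :
    kameko_poly (\prod_j (if j \in J then a j else b j)) =
      ([forall j, odd (e j)] && (J == set0))%:R.
  have [/existsP[i /andP[iJ iodd]]|] :=
      boolP [exists i, (i \in J) && ~~ odd (e i)].
    rewrite (bigD1 i) //= iJ /a (negbTE iodd) mul0r raddf0.
    by case: forallP => // /(_ i); rewrite (negbTE iodd).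
  move=> /existsPn Jodd.
  have -> : \prod_j (if j \in J then a j else b j) = 'X_[w J].
    rewrite mpolyXE_id; apply: eq_bigr => j _; rewrite /w mnmE /a /b.
    have := Jodd j; case: (j \in J) => /= [|_]; first by rewrite negbK => ->.
    by case: (e j) (e1 j) => [|[|]].
  rewrite kameko_polyX /kameko_mon.
  have -> : [forall j, odd (w J j)] = [forall j, odd (e j)] && (J == set0).
    apply/forallP/andP => [wodd|[/forallP eodd /eqP ->] j]; last first.
      by rewrite mnmE inE.
    have J0 j : (j \in J) = false.
      by have := wodd j; rewrite mnmE; case: (j \in J).
    split; last by apply/eqP/setP => j; rewrite J0 inE.
    by apply/forallP => j; have := wodd j; rewrite mnmE J0.
  case: andP => // -[_ /eqP ->].
  rewrite -[1](@mpolyX0 m); congr 'X_[_]; apply/mnmP => j.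
  rewrite !mnmE inE.
  by case: (e j) (e1 j) => [|[|]].
rewrite raddf_sum /= (eq_bigr _ (fun J _ => kamJ J)).
have [eodd|_] /= := boolP [forall j, odd (e j)]; last by rewrite big1.
have [->|k0] := eqVneq k 0%N.
  rewrite (bigD1 set0) ?cards0 //= eqxx big1 ?addr0 // => J /andP[_].
  by move/negbTE->.
rewrite big1 // => J /eqP Jk; case: eqP => // J0.
by rewrite -Jk J0 cards0 in k0.
Qed.

Lemma Sq_sqr k f : Sq k (f ^+ 2) = if odd k then 0 else Sq k./2 f ^+ 2.
Proof. by rewrite /Sq rmorphXn; apply: coef_sqr_pchar2 pchar2_mpoly. Qed.

Lemma kameko_mon_Sq k u :
  kameko_poly (Sq k 'X_[u]) = if odd k then 0 else Sq k./2 (kameko_mon u).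
Proof.
pose v : 'X_{1..m} := [multinom (u j)./2 | j < m].
pose e : 'X_{1..m} := [multinom odd (u j) : nat | j < m].
have uE : 'X_[u] = 'X_[v] ^+ 2 * 'X_[e] :> P.
  rewrite mpolyXn -mpolyXD; congr 'X_[_]; apply/mnmP => j.
  by rewrite mnmDE mulmnE !mnmE muln2 addnC odd_double_half.
have eE : [forall j, odd (e j)] = [forall j, odd (u j)].
  by apply: eq_forallb => j; rewrite mnmE oddb.
rewrite {1}uE Sq_cartan raddf_sum /=.
rewrite (eq_bigr (fun i : 'I_k.+1 =>
    if odd i then 0 else (Sq i./2 'X_[v]) *
      ([forall j, odd (u j)] && (k - i == 0)%N)%:R)); last first.
  move=> i _; rewrite Sq_sqr; case: (odd i); first by rewrite mul0r raddf0.
  rewrite kameko_poly_sqrM kameko_Sq_squarefree ?eE //.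
  by move=> j; rewrite mnmE leq_b1.
rewrite big_ord_recr /= subnn eqxx andbT big1 ?add0r => [|i _]; last first.
  by rewrite subn_eq0 leqNgt ltn_ord andbF mulr0 if_same.
rewrite /kameko_mon; case: forallP => [uodd|_]; last first.
  by rewrite mulr0 raddf0.
rewrite mulr1; congr (if _ then _ else Sq _ 'X_[_]).
apply/mnmP => j; rewrite !mnmE; have := uodd j.
by case: (u j) => //= i /negbTE io; rewrite uphalf_half io.
Qed.

Lemma kameko_poly_Sq k f :
  kameko_poly (Sq k f) = if odd k then 0 else Sq k./2 (kameko_poly f).
Proof.
rewrite {1}[f]mpolyE raddf_sum /= raddf_sum /=; transitivity
    (\sum_(u <- msupp f) f@_u *: (if odd k then 0 else Sq k./2 (kameko_mon u))).
  by apply: eq_bigr => u _; rewrite SqZ kameko_polyZ kameko_mon_Sq.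
case: (odd k); first by rewrite big1 // => u _; rewrite scaler0.
by rewrite /kameko_poly raddf_sum; apply: eq_bigr => u _; rewrite /= SqZ.
Qed.

Lemma kameko_poly_word I f :
  kameko_poly (Sq_word I f) =
    if all (predC odd) I then Sq_word (map half I) (kameko_poly f) else 0.
Proof.
elim: I => //= k I IH; rewrite kameko_poly_Sq IH.
by case: (odd k) => //=; case: all => //; rewrite raddf0.
Qed.

Lemma kameko_poly_hit f : f \in hit -> kameko_poly f \in hit.
Proof.
move=> /asboolP[k [c [v [Sv ->]]]]; rewrite raddf_sum rpred_sum // => i _.
rewrite /= kameko_polyZ rpredZ //; have [I [g [I0 _ ->]]] := Sv i.
rewrite kameko_poly_word; case: ifP => [Ieven|_]; last exact: rpred0.
apply: lspan_gen; exists (map half I), (kameko_poly g); split=> //.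
move: I0 Ieven; elim: I {Sv} => //= a I IH; rewrite !addn_gt0.
case/orP => [a0 /andP[ae _]|I0 /andP[_ /(IH I0) ->]]; last by rewrite orbT.
by case: a a0 ae => [|[|a]].
Qed.

Lemma kameko_poly_deg n f :
  f \in homdeg (m + 2 * n) -> kameko_poly f \in homdeg n.
Proof.
move=> /dhomogP fn; rewrite /kameko_poly big_seq rpred_sum // => u /fn /= du.
rewrite rpredZ // /kameko_mon; case: forallP => [uodd|_]; last exact: rpred0.
rewrite unfold_in dhomogX /= -(eqn_pmul2l (m := 2)) // -(eqn_add2l m) -du.
rewrite !mdegE big_distrr /= -[X in (X + _)%N]card_ord -sum1_card -big_split /=.
apply/eqP/eq_bigr => j _; rewrite mnmE; have := uodd j.
by case: (u j) => //= i io; rewrite mul2n halfK (negbTE io) subn0.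
Qed.

Definition kameko_quot (q : quotmod (hit : submodClosed P)) :
  quotmod (hit : submodClosed P) := cls hit (kameko_poly (repr q)).

Lemma kameko_quot_cls f :
  kameko_quot (cls hit f) = cls hit (kameko_poly f).
Proof.
apply/cls_eq; rewrite -raddfB; apply: kameko_poly_hit.
by apply/cls_eq; rewrite clsK.
Qed.

Lemma kameko_quot_linear : linear kameko_quot.
Proof.
move=> a p q; rewrite -[p]clsK -[q]clsK -linearP !kameko_quot_cls.
by rewrite !linearP.
Qed.

HB.instance Definition _ :=
  GRing.isLinear.Build F2 _ _ _ kameko_quot kameko_quot_linear.

Lemma kameko_quot_deg n q : q \in subquot hit (homdeg (m + 2 * n)) ->
  kameko_quot q \in subquot hit (homdeg n).
Proof.
move=> /asboolP[f fn ->]; rewrite kameko_quot_cls.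
by apply: subquot_cls; apply: kameko_poly_deg.
Qed.

Definition kameko (n : nat) (x : Qdeg (m + 2 * n)) : Qdeg n :=
  Sub (kameko_quot (val x)) (kameko_quot_deg (valP x)).

Lemma kameko_linear n : linear (@kameko n).
Proof. by move=> a x y; apply: val_inj; apply: kameko_quot_linear. Qed.

HB.instance Definition _ n :=
  GRing.isLinear.Build F2 (Qdeg (m + 2 * n)) (Qdeg n) _ (@kameko n)
    (@kameko_linear n).

Lemma kameko_monE n (x : Qdeg (m + 2 * n)) (u : 'X_{1..m}) :
  val x = cls hit 'X_[u] ->
  val (kameko x) =
    if [forall j, odd (u j)] then cls hit 'X_[kameko_half u] else 0.
Proof.
move=> xu; rewrite /kameko SubK xu kameko_quot_cls kameko_polyX /kameko_mon.
by case: ifP => // _; rewrite raddf0.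
Qed.

(* The entry of index t is omega_{t+1}. The list stops at the degree since
   u_j < 2 ^ mdeg u; see nth_weight. *)
Definition weight (u : 'X_{1..m}) : seq nat :=
  mkseq (fun t => \sum_(j < m) odd (u j %/ 2 ^ t))%N (mdeg u).

Lemma nth_weight u t :
  nth 0%N (weight u) t = (\sum_(j < m) odd (u j %/ 2 ^ t))%N.
Proof.
have [ltu|leu] := ltnP t (mdeg u); first by rewrite nth_mkseq.
rewrite nth_default ?size_mkseq // big1 // => j _.
rewrite divn_small //; apply: leq_ltn_trans (ltn_expl t (ltnSn 1)).
by apply: leq_trans leu; rewrite mdegE (bigD1 j) //= leq_addr.
Qed.

End Steenrod.

Arguments hit m _ : clear implicits.
Arguments homdeg m n _ : clear implicits.
Arguments P0 m _ : clear implicits.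
Arguments Ppos m _ : clear implicits.
Arguments kameko m n x : clear implicits.

(* Weight vectors are lists read with default value 0, so that trailing zeros
   are irrelevant to all the definitions below. *)
Definition wdeg (w : seq nat) : nat :=
  (\sum_(t < size w) 2 ^ t * nth 0 w t)%N.

Definition wlt (v w : seq nat) : Prop := exists t,
  (forall s, (s < t)%N -> nth 0%N v s = nth 0%N w s) /\
  (nth 0%N v t < nth 0%N w t)%N.

Definition wle (v w : seq nat) : Prop :=
  wlt v w \/ forall t, nth 0%N v t = nth 0%N w t.

Section Weights.
Variables (m : nat) (w : seq nat).
Local Notation P := {mpoly F2[m]}.

Definition Ple : {pred P} := lspan (fun f => exists u : 'X_{1..m},
  [/\ mdeg u = wdeg w, wle (weight u) w & f = 'X_[u]]).

Definition Plt : {pred P} := lspan (fun f => exists u : 'X_{1..m},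
  [/\ mdeg u = wdeg w, wlt (weight u) w & f = 'X_[u]]).

HB.instance Definition _ := GRing.SubmodClosed.on Ple.
HB.instance Definition _ := GRing.SubmodClosed.on Plt.

Definition Qw_rel : {pred P} := addsm (capsm (hit m) Ple) Plt.

HB.instance Definition _ := GRing.SubmodClosed.on Qw_rel.

Definition Qw := submodule (subquot Qw_rel Ple).

Definition Qw_pos : {pred Qw} := lspan (fun x => exists u : 'X_{1..m},
  [/\ 'X_[u] \in Ple, 'X_[u] \in Ppos m & val x = cls Qw_rel 'X_[u]]).

HB.instance Definition _ := GRing.SubmodClosed.on Qw_pos.

End Weights.

Arguments Ple m w _ : clear implicits.
Arguments Plt m w _ : clear implicits.
Arguments Qw_rel m w _ : clear implicits.
Arguments Qw_pos m w _ : clear implicits.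

(* Main.v *)
From HB Require Import structures.
Require Import Defs.
From mathcomp Require Import all_boot all_order all_algebra.
From mathcomp Require Import boolp mpoly zify.

(* The weight (3,3,2,1,1) is that of the minimal spike of degree 41, so every
   monomial of smaller weight is hit (Singer's criterion); here this follows by
   pushing Sq^d(g) = g^2 off a single variable, and then climbing from degree 8
   to 19 to 41 with x y z (Sq^k f)^2 = Sq^(2k)(x y z f^2) + terms with
   omega_1 = 1.  The same Cartan formula shows that x_1 ... x_5 g^2 is, for g
   hit, a hit plus monomials with omega_1 <= 3, so a class in the kernel of
   Kameko's map is represented by monomials with omega_1 <= 3.  Those of weight
   above (3,3,2,1,1) have weight beginning with (3,5), (3,3,4) or (3,3,2,3);
   they are all strictly inadmissible: since Sq^k(f h^(2^s)) = Sq^k(f) h^(2^s)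
   for k < 2^s, it is enough to exhibit, up to permutation of the variables, a
   sum of Sq^k(f) with k < 2^s whose other terms have smaller weight or are
   already reduced.  Hence the kernel is the span of the monomials of weight at
   most (3,3,2,1,1) and of P^0, and the decomposition into P^0 and P^(>0)
   commutes with the Steenrod operations. *)

Set Implicit Arguments.
Unset Strict Implicit.
Unset Printing Implicit Defensive.

Import GRing.Theory.
Local Open Scope ring_scope.

(** * Steenrod squares of monomials *)

(** Row [a] of Pascal's triangle mod 2: the total square of x^a is x^a (1 + x t)^a, so entry j
    decides whether Sq^j(x^a) vanishes. The boolean form is meant for [vm_compute]. *)
Fixpoint binom_parity (a : nat) : seq bool :=
  if a is b.+1 then
    let r := binom_parity b in
    [seq x.1 (+) x.2 | x <- zip (rcons r false) (false :: r)]
  else [:: true].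

Fixpoint sq_mon (k : nat) (u : seq nat) : seq (seq nat) :=
  if u is a :: u' then
    flatten [seq [seq (a + j)%N :: v | v <- sq_mon (k - j) u']
            | j <- iota 0 k.+1 & nth false (binom_parity a) j]
  else if k is 0%N then [:: [::]] else [::].

Lemma size_binom_parity a : size (binom_parity a) = a.+1.
Proof.
elim: a => // a IH; rewrite [binom_parity _]/(map _ (zip _ _)) size_map size_zip.
by rewrite size_rcons [size (_ :: _)]/= IH minnn.
Qed.

Lemma nth_binom_parityS a j :
  nth false (binom_parity a.+1) j =
    nth false (binom_parity a) j (+)
    ((0 < j)%N && nth false (binom_parity a) j.-1).
Proof.
set r := binom_parity a; have sr : size r = a.+1 by apply: size_binom_parity.
have [lt|ge] := ltnP j a.+2; last first.
  rewrite !nth_default ?size_binom_parity ?sr ?andbF //; lia.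
rewrite (nth_map (false, false)) ?size_zip ?size_rcons ?[size (_ :: _)]/= ?sr ?minnn //.
rewrite nth_zip ?size_rcons // [fst _]/= [snd _]/= nth_rcons sr.
case: j lt => [|j] lt //=; rewrite ?addbF //; congr (_ (+) _).
by have [//|ge] := ltnP j.+1 a.+1; rewrite if_same [RHS]nth_default ?sr.
Qed.

Section Monomials.
Variable m : nat.
Local Notation P := {mpoly F2[m]}.

Lemma addpp (f : P) : f + f = 0.
Proof. exact: addrr_pchar2 (pchar2_mpoly m) f. Qed.

Lemma oppp (f : P) : - f = f.
Proof. by apply/eqP; rewrite eq_sym -subr_eq0 opprK addpp. Qed.

Lemma sqrpD (f g : P) : (f + g) ^+ 2 = f ^+ 2 + g ^+ 2.
Proof. by rewrite sqrrD mulrn_pchar ?pchar2_mpoly ?addr0. Qed.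

Lemma sqrp_sum I (r : seq I) (F : I -> P) :
  (\sum_(i <- r) F i) ^+ 2 = \sum_(i <- r) F i ^+ 2.
Proof. by elim/big_rec2: _ => [|i x y _ <-]; rewrite ?expr0n // sqrpD. Qed.

Lemma Sq_pow k a (i : 'I_m) :
  Sq k ('X_i ^+ a) =
    if nth false (binom_parity a) k then 'X_i ^+ (a + k) else 0 :> P.
Proof.
elim: a k => [|a IH] k; first by rewrite expr0 Sq_const; case: k => [|[|?]].
rewrite nth_binom_parityS exprSr Sq_cartan big_ord_recr /= subnn Sq_gen0 IH.
case: k => [|k].
  by rewrite big_ord0 add0r addbF !addn0; case: ifP; rewrite ?mul0r // -exprSr.
rewrite big_ord_recr /= subSnn Sq_gen1 IH big1 => [|j _]; last first.
  by rewrite Sq_gen_gt1 ?mulr0 // subSn ?ltnS ?subn_gt0 // ltnW.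
have -> : 'X_i ^+ (a.+1 + k.+1) = 'X_i ^+ (a + k) * 'X_i ^+ 2 :> P.
  by rewrite -exprD addn2 addnS addSn.
have -> : 'X_i ^+ (a + k.+1) = 'X_i ^+ (a + k) * 'X_i :> P by rewrite addnS exprSr.
rewrite add0r; case: (nth _ _ k.+1); case: (nth _ _ k) => /=.
- by rewrite -mulrA -expr2 addpp.
- by rewrite mul0r add0r -mulrA -expr2.
- by rewrite mul0r addr0.
- by rewrite !mul0r addr0.
Qed.

(** The order [p] of the variables is kept apart from the exponents, so that one computation on
    exponent lists serves all permutations of the variables. *)
Definition pmon (p : seq 'I_m) (u : seq nat) : P :=
  \prod_(x <- zip p u) 'X_(x.1) ^+ x.2.

Lemma pmon_cons i p a u : pmon (i :: p) (a :: u) = 'X_i ^+ a * pmon p u.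
Proof. by rewrite /pmon /= big_cons. Qed.

Lemma pmon_nil p : pmon p [::] = 1.
Proof. by rewrite /pmon; case: p => [|? ?]; rewrite big_nil. Qed.

Lemma Sq_pmon k p u : size p = size u ->
  Sq k (pmon p u) = \sum_(v <- sq_mon k u) pmon p v.
Proof.
elim: u p k => [|a u IH] [|i p] k //.
  by rewrite /pmon /= big_nil Sq_const; case: k => [|k];
    rewrite ?big_nil // big_seq1 big_nil.
move=> [sz]; rewrite pmon_cons Sq_cartan [sq_mon _ _]/(flatten _).
rewrite big_flatten big_map big_filter.
rewrite -[X in iota 0 X]subn0 -/(index_iota 0 k.+1) big_mkcond big_mkord.
apply: eq_bigr => j _; rewrite Sq_pow; case: ifP => _; last by rewrite mul0r.
rewrite IH // mulr_sumr big_map; apply: eq_bigr => v _.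
by rewrite pmon_cons.
Qed.

Lemma sq_monP k u v : v \in sq_mon k u ->
  size v = size u /\ sumn v = (k + sumn u)%N.
Proof.
elim: u k v => [|a u IH] k v; first by case: k => //= /[!inE] /eqP ->.
rewrite [sq_mon _ _]/(flatten _); case/flattenP => s /mapP[j].
rewrite mem_filter mem_iota => /andP[_ jk] -> /mapP[w].
by move=> /IH[sw tw] ->; rewrite /= sw tw; split=> //; lia.
Qed.

Lemma pmonM p u v : size p = size u -> size p = size v ->
  pmon p u * pmon p v = pmon p [seq (x.1 + x.2)%N | x <- zip u v].
Proof.
elim: p u v => [|i p IH] [|a u] [|b v] //=; first by rewrite !pmon_nil mul1r.
by move=> [su] [sv]; rewrite !pmon_cons exprD mulrACA IH.
Qed.

Lemma pmonX p u k : size p = size u ->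
  pmon p u ^+ k = pmon p [seq (k * x)%N | x <- u].
Proof.
elim: p u => [|i p IH] [|a u] //=; first by rewrite pmon_nil expr1n.
by move=> [su]; rewrite !pmon_cons exprMn IH // -exprM mulnC.
Qed.

Lemma pmonE p (u : 'X_{1..m}) : perm_eq p (enum 'I_m) ->
  pmon p [seq u i | i <- p] = 'X_[u].
Proof.
move=> pp; rewrite mpolyXE_id /pmon -[RHS]big_enum /= -(perm_big _ pp) /=.
elim: p {pp} => [|i p IH] /=; rewrite ?big_nil ?big_cons //=.
by rewrite IH.
Qed.

Lemma pmon_mpolyX p s : perm_eq p (enum 'I_m) -> size s = m ->
  exists2 u : 'X_{1..m}, [seq u i | i <- p] = s & pmon p s = 'X_[u].
Proof.
move=> pp ss; pose u : 'X_{1..m} := [multinom nth 0%N s (index i p) | i < m].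
have sp : size p = m by rewrite (perm_size pp) size_enum_ord.
have us : [seq u i | i <- p] = s.
  have up : uniq p by rewrite (perm_uniq pp) enum_uniq.
  apply: (@eq_from_nth _ 0%N); rewrite size_map sp // => j jm.
  by rewrite (nth_map (Ordinal jm)) ?sp // mnmE index_uniq ?sp.
by exists u; rewrite // -[in LHS]us pmonE.
Qed.

Lemma pmon_perm p u v : perm_eq p (enum 'I_m) -> size u = m -> perm_eq u v ->
  exists2 q, perm_eq q (enum 'I_m) & pmon p u = pmon q v.
Proof.
move=> pp su uv; have [w uE ->] := pmon_mpolyX pp su.
have /(perm_iotaP 0%N)[I pI vE] : perm_eq v u by rewrite perm_sym.
have sp : size p = m by rewrite (perm_size pp) size_enum_ord.
rewrite su in pI.
have Im j : j \in I -> (j < m)%N by rewrite (perm_mem pI) mem_iota.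
(* Only a positive [m] provides the default element of ['I_m] that [nth] needs. *)
case: (posnP m) => [m0|m_gt0].
  exists (enum 'I_m); first exact: perm_refl.
  have v0 : v = [::] by apply: size0nil; rewrite -(perm_size uv) su.
  by rewrite v0 pmon_nil mpolyXE_id big1 // => i; have := ltn_ord i; rewrite {2}m0.
pose i0 := Ordinal m_gt0; pose q := [seq nth i0 p j | j <- I].
have qp : perm_eq q (enum 'I_m).
  apply: perm_trans (perm_map (nth i0 p) pI) _.
  by rewrite map_nth_iota0 ?sp // take_oversize ?sp.
exists q => //; have -> : v = [seq w i | i <- q].
  rewrite vE -map_comp; apply/eq_in_map => j jI /=.
  by rewrite -uE (nth_map i0) // sp Im.
by rewrite pmonE.
Qed.

Lemma Sq0_id (f : P) : Sq 0 f = f.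
Proof.
have Sq0_pmon p v : Sq 0 (pmon p v) = pmon p v.
  elim: v p => [|a v IH] [|i p]; rewrite ?pmon_nil ?Sq_const //.
    by rewrite /pmon big_nil Sq_const.
  rewrite pmon_cons Sq_cartan big_ord1 IH Sq_pow addn0.
  suff -> : nth false (binom_parity a) 0 by [].
  by elim: a => // a IHa; rewrite nth_binom_parityS IHa.
rewrite [f]mpolyE raddf_sum; apply: eq_bigr => u _ /=; rewrite SqZ.
by rewrite -(pmonE u (perm_refl _)) Sq0_pmon.
Qed.

(** On a square, odd operations vanish and even ones halve their index; an index strictly between 0
    and 2^s becomes odd before s halvings. *)
Lemma Sq_pow2_eq0 s k (g : P) : (0 < k < 2 ^ s)%N -> Sq k (g ^+ (2 ^ s)) = 0.
Proof.
elim: s k => [|s IH] k; first by rewrite expn0 ltnS andbC leqn0; case: k.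
move=> kb; rewrite expnS mulnC exprM Sq_sqr; case: ifP => // ko.
rewrite IH ?expr0n //; move: kb; rewrite expnS; lia.
Qed.

(** Only the Cartan term that leaves the power of [g] untouched survives. This lets a relation
    between exponents below 2^s be multiplied by any 2^s-th power. *)
Lemma Sq_mul_pow2 s k (f g : P) : (k < 2 ^ s)%N ->
  Sq k (f * g ^+ (2 ^ s)) = Sq k f * g ^+ (2 ^ s).
Proof.
move=> ks; rewrite Sq_cartan big_ord_recr /= subnn Sq0_id big1 ?add0r // => i _.
by rewrite Sq_pow2_eq0 ?mulr0 // subn_gt0 ltn_ord (leq_ltn_trans (leq_subr _ _)).
Qed.

End Monomials.

(** * Reducing monomials by certificates *)

(* omega t is the paper's omega_{t+1}. *)
Definition omega (t : nat) (u : seq nat) : nat :=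
  count (fun a => odd (a %/ 2 ^ t)) u.

Definition omegas (s : nat) (u : seq nat) : seq nat := mkseq (omega^~ u) s.

Fixpoint lexlt (v w : seq nat) : bool :=
  if (v, w) is (a :: v', b :: w') then (a < b)%N || (a == b) && lexlt v' w'
  else false.

(** A normal form for monomials up to permutation of the variables and 2^s-th powers as factors. *)
Definition orbit (s : nat) (u : seq nat) : seq nat :=
  sort geq [seq (a %% 2 ^ s)%N | a <- u].

Fixpoint partitions (k n b : nat) : seq (seq nat) :=
  if k is k'.+1 then
    flatten [seq [seq a :: v | v <- partitions k' (n - a) a]
            | a <- iota 0 (minn n b).+1]
  else if n is 0%N then [:: [::]] else [::].

Definition wval (w : seq nat) : nat := foldr (fun a d => (a + d.*2)%N) 0%N w.

Definition reducible (s : nat) (w : seq nat) (done : seq (seq nat)) (v : seq nat) :=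
  lexlt (omegas s v) w || (orbit s v \in done).

(** Cancellation in characteristic 2: repeated terms of a sum disappear in pairs. *)
Definition odd_part (T : eqType) (l : seq T) : seq T :=
  [seq v <- undup l | odd (count_mem v l)].

Definition residue s w done (l : seq (nat * seq nat)) : seq (seq nat) :=
  odd_part [seq v <- flatten [seq sq_mon x.1 x.2 | x <- l]
           | ~~ reducible s w done v].

(* Each entry of the certificate is a list of pairs (k, f) standing for the sum
   of the Sq^k X^f; modulo the monomials reduced so far it must be a single
   monomial M, whose orbit is then reduced as well.  In the end every monomial
   of weight w with exponents below 2^s has to be reduced. *)
Fixpoint check (m s : nat) (w : seq nat) (done : seq (seq nat))
    (cert : seq (seq (nat * seq nat))) : bool :=
  if cert is l :: cert' then
    if residue s w done l is [:: M] then
      [&& all (fun x => [&& 0 < x.1 < 2 ^ s, size x.2 == m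
                         & x.1 + sumn x.2 == wval w])%N l,
          all (fun a => a < 2 ^ s)%N M
        & check m s w (orbit s M :: done) cert']
    else false
  else all (fun r => (omegas s r == w) ==> (r \in done))
           (partitions m (wval w) (2 ^ s).-1).

Lemma odd_divn_modn2 s t a : (t < s)%N ->
  odd ((a %% 2 ^ s) %/ 2 ^ t) = odd (a %/ 2 ^ t).
Proof.
move=> ts; rewrite [in RHS](divn_eq a (2 ^ s)).
have -> : (a %/ 2 ^ s * 2 ^ s = (a %/ 2 ^ s * 2 ^ (s - t.+1) * 2) * 2 ^ t)%N.
  by rewrite -!mulnA -expnS -expnD subnK.
by rewrite divnMDl ?expn_gt0 // oddD oddM andbF.
Qed.

Lemma omegas_mod s u : omegas s [seq (a %% 2 ^ s)%N | a <- u] = omegas s u.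
Proof.
apply/eq_in_map => t; rewrite mem_iota => ts; rewrite /omega count_map.
by apply: eq_count => a /=; apply: odd_divn_modn2.
Qed.

Lemma omegas_orbit s u : omegas s (orbit s u) = omegas s u.
Proof.
rewrite -[RHS]omegas_mod; apply/eq_in_map => t _.
by apply/permP; rewrite perm_sort.
Qed.

Lemma sumn_omega u : sumn u = (omega 0 u + 2 * sumn [seq a %/ 2 | a <- u])%N.
Proof.
rewrite /omega; elim: u => //= a u ->.
rewrite expn0 divn1; lia.
Qed.

Lemma omegasS s u :
  omegas s.+1 u = omega 0 u :: omegas s [seq (a %/ 2)%N | a <- u].
Proof.
rewrite /omegas /mkseq /= (iotaDl 1 0) -map_comp; congr (_ :: _).
apply: eq_map => t /=; rewrite /omega count_map; apply: eq_count => a /=.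
by rewrite -divnMA -expnS.
Qed.

(** With the degree fixed, this gives the congruences from which [lia] later rules out most weight
    vectors. *)
Lemma sumn_omegas s u :
  sumn u = (wval (omegas s u) + 2 ^ s * sumn [seq a %/ 2 ^ s | a <- u])%N.
Proof.
elim: s u => [|s IH] u.
  rewrite mul1n; congr sumn; rewrite -[LHS]map_id; apply: eq_map => a.
  by rewrite divn1.
rewrite sumn_omega omegasS /= (IH [seq _ | _ <- u]) -map_comp.
have -> : [seq (a %/ 2 ^ s.+1)%N | a <- u] =
    map ((fun a => a %/ 2 ^ s)%N \o (fun a => a %/ 2)%N) u.
  by apply: eq_map => a /=; rewrite -divnMA -expnS.
rewrite expnS; lia.
Qed.

Lemma partitionsP k n b u : size u = k -> sumn u = n -> sorted geq u ->
  all (fun a => a <= b)%N u -> u \in partitions k n b.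
Proof.
elim: k n b u => [|k IH] n b [|a u] //; first by move=> _ <-.
move=> [su] un ps /andP[ab _]; rewrite /= in un ps.
apply/flattenP; exists [seq a :: v | v <- partitions k (n - a) a].
  by apply/mapP; exists a => //; rewrite mem_iota; lia.
rewrite mem_map => [|x y []//]; apply: IH => //; first lia.
  exact: path_sorted ps.
by apply: (order_path_min _ ps) => x y z; lia.
Qed.

(** * Soundness of the certificates *)

Section Reduction.
Variables (m n : nat) (T : submodClosed {mpoly F2[m]}).
Hypothesis hitT : {subset hit m <= T}.
Local Notation P := {mpoly F2[m]}.

(** All orders of the variables are required at once, because [T] is only known to contain the hits
    and need not be symmetric. *)
Definition all_in (u : seq nat) : Prop :=
  forall p, perm_eq p (enum 'I_m) -> pmon p u \in T.

Lemma Sq_hit k (f : P) : (0 < k)%N -> Sq k f \in hit m.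
Proof.
move=> k0; apply: lspan_gen; exists [:: k], f; split=> //=.
by rewrite addn0.
Qed.

Lemma sum_odd_part (I : eqType) (l : seq I) (F : I -> P) :
  \sum_(v <- l) F v = \sum_(v <- odd_part l) F v.
Proof.
rewrite -big_undup_iterop_count big_filter [RHS]big_mkcond /=.
apply: eq_bigr => v _; rewrite -[iterop _ _ _ _]/(F v *+ _).
have -> k : F v *+ k = if odd k then F v else 0.
  rewrite -{1}[k]odd_double_half mulrnDr -muln2 mulnC mulrnA mulr2n addpp mul0rn addr0.
  by case: (odd k).
by [].
Qed.

Lemma sumn_mnm p (u : 'X_{1..m}) : perm_eq p (enum 'I_m) ->
  sumn [seq u i | i <- p] = mdeg u.
Proof.
by move=> pp; rewrite sumnE big_map (perm_big _ pp) /= big_enum mdegE.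
Qed.

Definition addmul s (v h : seq nat) : seq nat :=
  [seq (x.1 + x.2)%N | x <- zip v [seq (2 ^ s * x)%N | x <- h]].

Lemma size_addmul s v h : size v = size h -> size (addmul s v h) = size v.
Proof. by move=> sz; rewrite size_map size_zip size_map sz minnn. Qed.

Lemma mod_addmul s v h : size v = size h ->
  [seq (a %% 2 ^ s)%N | a <- addmul s v h] = [seq (a %% 2 ^ s)%N | a <- v].
Proof.
elim: v h => [|a v IH] [|b h] //= [sz]; rewrite -(IH h) //.
by rewrite addnC mulnC modnMDl.
Qed.

Lemma sumn_addmul s v h : size v = size h ->
  sumn (addmul s v h) = (sumn v + 2 ^ s * sumn h)%N.
Proof.
elim: v h => [|a v IH] [|b h] //=; first by rewrite muln0.
move=> [sz]; rewrite -/(addmul s v h) IH //; lia.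
Qed.

Lemma pmon_addmul s (p : seq 'I_m) v h : size p = size v -> size p = size h ->
  pmon p (addmul s v h) = pmon p v * pmon p h ^+ (2 ^ s).
Proof. by move=> sv sh; rewrite pmonX // pmonM ?size_map. Qed.

Lemma addmul_div s u :
  addmul s [seq (a %% 2 ^ s)%N | a <- u] [seq (a %/ 2 ^ s)%N | a <- u] = u.
Proof.
elim: u => //= a u IH; rewrite -[in RHS]IH; congr (_ :: _).
by rewrite addnC mulnC -divn_eq.
Qed.

(** The relation of the certificate is multiplied by a 2^s-th power. Its squares stay hit by
    [Sq_mul_pow2], and its reducible monomials stay reducible because their exponents mod 2^s do not
    change; what remains is the monomial [u]. *)
Lemma residue_sound s w done l M :
  (forall u, size u = m -> sumn u = n -> reducible s w done u -> all_in u) ->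
  residue s w done l = [:: M] ->
  all (fun x => [&& 0 < x.1 < 2 ^ s, size x.2 == m
                 & x.1 + sumn x.2 == wval w])%N l ->
  all (fun a => a < 2 ^ s)%N M ->
  forall u, size u = m -> sumn u = n -> orbit s u = orbit s M -> all_in u.
Proof.
move=> red resM /allP lP /allP Ms u su un uM p pp.
have sp q : perm_eq q (enum 'I_m) -> size q = m.
  by move=> qq; rewrite (perm_size qq) size_enum_ord.
have modM : [seq (a %% 2 ^ s)%N | a <- M] = M.
  rewrite -[RHS]map_id; apply/eq_in_map => a aM /=.
  by rewrite modn_small // Ms.
set r := [seq (a %% 2 ^ s)%N | a <- u]; set h := [seq (a %/ 2 ^ s)%N | a <- u].
have rM : perm_eq r M.
  by rewrite -(perm_sort geq) -/(orbit s u) uM /orbit modM perm_sort.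
(* The variables are reordered by [q] so that the residues of [u] become [M] itself; the quotients
   form the monomial [e], which is then read in the same order as [h']. *)
have [q qq rq] := pmon_perm pp (etrans (size_map _ _) su : size r = m) rM.
have [e eh hX] := pmon_mpolyX pp (etrans (size_map _ _) su : size h = m).
pose h' := [seq e i | i <- q].
have sh' : size h' = m by rewrite size_map sp.
rewrite -(addmul_div s u) pmon_addmul ?size_map ?sp // -/r -/h rq hX -(pmonE e qq) -/h'.
have lM v : v \in flatten [seq sq_mon x.1 x.2 | x <- l] ->
    size v = m /\ sumn v = wval w.
  case/flattenP => c /mapP[x /lP/and3P[_ /eqP sx /eqP tx] ->] /sq_monP[-> ->].
  by rewrite sx.
have sM : M \in residue s w done l by rewrite resM mem_head.
move: sM; rewrite mem_filter mem_undup mem_filter => /and3P[_ _ /lM[sM tM]].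
have nE : (wval w + 2 ^ s * sumn h')%N = n.
  rewrite -un -(addmul_div s u) sumn_addmul ?size_map // -/r -/h.
  rewrite (perm_sumn rM) tM; congr (_ + _ * _)%N.
  by rewrite (sumn_mnm e qq) -(sumn_mnm e pp) eh.
(* The relation in the variables [q]: hits on the left; on the right, the reducible monomials and,
   after cancellation, [M] alone. *)
have: \sum_(x <- l) Sq x.1 (pmon q x.2) =
    \sum_(v <- flatten [seq sq_mon x.1 x.2 | x <- l]) pmon q v.
  rewrite big_flatten big_map; apply: eq_big_seq => x /lP/and3P[_ /eqP sx _].
  by rewrite Sq_pmon // sx sp.
rewrite (bigID (reducible s w done)) /= -[X in _ = _ + X]big_filter.
rewrite [X in _ = _ + X]sum_odd_part.
rewrite -/(residue s w done l) resM big_seq1 => /(canLR (addKr _)) <-.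
rewrite oppp mulrDl rpredD // mulr_suml.
  rewrite big_seq_cond rpred_sum // => v /andP[/lM[sv tv] rv].
  rewrite -pmon_addmul ?sp ?sv // ?sh' //; apply: red => //.
  - by rewrite size_addmul ?sv ?sh'.
  - by rewrite sumn_addmul ?sv ?sh' // tv.
  - rewrite /reducible -omegas_mod /orbit mod_addmul ?sv ?sh' //.
    by rewrite omegas_mod.
rewrite big_seq rpred_sum // => x /lP/and3P[/andP[x0 xs] _ _].
by rewrite -Sq_mul_pow2 //; apply/hitT/Sq_hit.
Qed.

(** Induction on the certificate. The invariant is that everything reducible with respect to [done]
    lies in [T]; each entry enlarges [done] by one orbit. *)
Lemma check_sound s w cert :
  (forall u, size u = m -> sumn u = n -> lexlt (omegas s u) w -> all_in u) ->
  check m s w [::] cert ->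
  forall u, size u = m -> sumn u = n -> omegas s u = w -> all_in u.
Proof.
move=> low; have: forall u, size u = m -> sumn u = n ->
  reducible s w [::] u -> all_in u by move=> u su un /orP[/low|//]; apply.
elim: cert [::] => [|l cert IH] done red /= => [/allP chk u su un uw|].
  suff ud : orbit s u \in done by apply: red; rewrite // /reducible ud orbT.
  (* The residues have no binary digit from position [s] on, so their sum is exactly [wval w] and
     the final enumeration of [check] meets them. *)
  have: orbit s u \in partitions m (wval w) (2 ^ s).-1.
    apply: partitionsP.
    - by rewrite size_sort size_map.
    - rewrite (sumn_omegas s) omegas_orbit uw -[RHS]addn0; congr (_ + _)%N.
      rewrite (perm_sumn (perm_map _ (permEl (perm_sort _ _)))) -map_comp.
      apply/eqP; rewrite muln_eq0; apply/orP; right.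
      rewrite sumnE big_map big1 // => a _ /=.
      by rewrite divn_small // ltn_mod expn_gt0.
    - by apply: sort_sorted => x y; apply: leq_total.
    - rewrite all_sort all_map; apply/allP => a _ /=.
      by rewrite -ltnS prednK ?expn_gt0 // ltn_mod expn_gt0.
  by move=> /chk; rewrite omegas_orbit uw eqxx.
case E: residue => [|M []] // /and3P[lP Ms /IH]; apply=> u su un.
rewrite /reducible inE orbCA => /predU1P[uM|]; last exact: red.
exact: (residue_sound red E lP Ms).
Qed.

End Reduction.

(** * Hits in a given degree *)

Section HomogeneousHits.
Variable m : nat.
Local Notation P := {mpoly F2[m]}.

(** Homogeneous generators, each a single square of a monomial, on which the Cartan formula can be
    applied with control of the degree. *)
Definition hit_in (n : nat) : {pred P} := lspan (fun g => exists k u,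
  [/\ (0 < k)%N, (k + mdeg u)%N = n & g = Sq k 'X_[u]]).

HB.instance Definition _ n := GRing.SubmodClosed.on (hit_in n).

Lemma hit_in_hit n : {subset hit_in n <= hit m}.
Proof. by apply: lspan_min => f [k [u [k0 _ ->]]]; apply: Sq_hit. Qed.

Lemma Sq_hit_in k (u : 'X_{1..m}) : (0 < k)%N -> Sq k 'X_[u] \in hit_in (k + mdeg u).
Proof. by move=> k0; apply: lspan_gen; exists k, u. Qed.

Lemma Sq_homog k (u : 'X_{1..m}) : Sq k 'X_[u] \is (k + mdeg u).-homog.
Proof.
rewrite -(pmonE u (perm_refl _)) Sq_pmon ?size_map //.
rewrite big_seq rpred_sum // => v /sq_monP[]; rewrite size_map size_enum_ord => sv tv.
have [w ws ->] := pmon_mpolyX (perm_refl _) sv.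
rewrite dhomogX; apply/eqP; transitivity (sumn v); last first.
  by rewrite tv (sumn_mnm u (perm_refl _)).
by rewrite -ws (sumn_mnm w (perm_refl _)).
Qed.

(** In each word the outermost square of positive degree is kept and its argument is expanded into
    monomials; projecting to degree [n] then discards the terms of other degrees. *)
Lemma hit_hit_in n f : f \in hit m -> f \is n.-homog -> f \in hit_in n.
Proof.
move=> fhit /pihomog_dE <-; move: fhit => /asboolP[k [c [v [Sv ->]]]].
rewrite raddf_sum rpred_sum //= => i _; rewrite linearZ rpredZ //=.
have [I [g [I0 _ ->]]] := Sv i.
have [j [h [j0 ->]]] : exists j h, (0 < j)%N /\ Sq_word I g = Sq j h.
  elim: I I0 => //= a I IH; case: (posnP a) => [-> /IH|a0 _];
    last by exists a, (Sq_word I g).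
  by rewrite Sq0_id.
rewrite [h]mpolyE !raddf_sum rpred_sum //= => u _.
rewrite SqZ linearZ rpredZ //=.
have [<-|ne] := eqVneq (j + mdeg u)%N n.
  by rewrite (pihomog_dE (Sq_homog _ _)) Sq_hit_in.
by rewrite (pihomog_ne0 ne (Sq_homog _ _)) rpred0.
Qed.

(** By Frobenius, the total square of x^(2^j) has only two terms. *)
Lemma Sq_var_pow2 k j (i : 'I_m) : Sq k ('X_i ^+ (2 ^ j)) =
  if k == 0%N then 'X_i ^+ (2 ^ j) else
  if k == (2 ^ j)%N then 'X_i ^+ (2 ^ j.+1) else 0 :> P.
Proof.
elim: j k => [|j IH] k.
  by case: k => [|[|k]]; rewrite !expr1 ?Sq_gen0 ?Sq_gen1 ?Sq_gen_gt1.
have E l : (2 ^ l.+1 = (2 ^ l).*2)%N by rewrite expnS mul2n.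
rewrite (E j.+1) E -[in LHS]muln2 exprM Sq_sqr IH -[k in RHS]odd_double_half.
case: (odd k) => /=.
  by rewrite ifN //; case: eqP => // /(congr1 odd); rewrite /= !odd_double.
rewrite add0n double_eq0 -(inj_eq double_inj).
case: eqP => _; first by rewrite -exprM muln2.
by rewrite (inj_eq double_inj); case: eqP => _; rewrite ?expr0n // -exprM muln2 E.
Qed.

Lemma Sq_var_pow2M c j (i : 'I_m) (g : P) :
  Sq c ('X_i ^+ (2 ^ j) * g) = 'X_i ^+ (2 ^ j) * Sq c g +
    (if (2 ^ j <= c)%N then 'X_i ^+ (2 ^ j.+1) * Sq (c - 2 ^ j) g else 0).
Proof.
rewrite Sq_cartan big_ord_recl /= Sq_var_pow2 subn0; congr (_ + _).
have j0 : (0 < 2 ^ j)%N by rewrite expn_gt0.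
case: leqP => [le|gt].
  have lt : ((2 ^ j).-1 < c)%N by rewrite prednK.
  rewrite (bigD1 (Ordinal lt)) //= big1 => [|l nl]; rewrite Sq_var_pow2 /bump leq0n add1n.
    by rewrite prednK // eqxx addr0 gtn_eqF.
  rewrite ifN ?mul0r //; apply: contra nl => /eqP E; apply/eqP/val_inj => /=.
  by rewrite -E.
rewrite big1 // => l _; rewrite Sq_var_pow2 /bump leq0n add1n ifN ?mul0r //.
by have := ltn_ord l; lia.
Qed.

(** The property [top], that squares above the degree vanish and the one in the degree is Frobenius,
    is multiplicative, so it passes from variables to monomials. *)
Lemma Sq_top (u : 'X_{1..m}) : Sq (mdeg u) 'X_[u] = 'X_[u] ^+ 2 :> P.
Proof.
pose top d (f : P) := (forall k, (d < k)%N -> Sq k f = 0) /\ Sq d f = f ^+ 2.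
have topM d e f g : top d f -> top e g -> top (d + e)%N (f * g).
  move=> [f0 fd] [g0 ge]; split=> [k dek|].
    rewrite Sq_cartan big1 // => i _; have [di|id] := ltnP d i.
      by rewrite f0 ?mul0r.
    by rewrite g0 ?mulr0 //; lia.
  have ltd : (d < (d + e).+1)%N by lia.
  rewrite Sq_cartan (bigD1 (Ordinal ltd)) //= addKn fd ge -exprMn big1 ?addr0 // => i ni.
  have [di|id] := ltnP d i; first by rewrite f0 ?mul0r.
  rewrite g0 ?mulr0 //; suff : (i : nat) != d by lia.
  by apply: contra ni => /eqP E; apply/eqP/val_inj.
have top0 : top 0%N 1 by split=> [[|k]|]; rewrite // Sq_const ?expr1n.
have topX i a : top a ('X_i ^+ a).
  elim: a => // a IH; rewrite exprS -add1n; apply: topM => //.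
  by split=> [k|]; [exact: Sq_gen_gt1 | exact: Sq_gen1].
have topp v p : size p = size v -> top (sumn v) (pmon p v).
  elim: v p => [|a v IH] [|i p] // => [_|[sz]]; first by rewrite pmon_nil.
  by rewrite pmon_cons; apply: topM => //; apply: IH.
have := topp [seq u i | i <- enum 'I_m] (enum 'I_m).
by rewrite size_map (sumn_mnm u (perm_refl _)) (pmonE u (perm_refl _)) => /(_ erefl) [].
Qed.

(* With N = d + 1, the polynomials x Sq^d g, x^2 Sq^(d-1) g, x^4 Sq^(d-3) g, ...
   agree modulo hits, and the last one, where 0 < c < 2^j, is Sq^c(x^(2^j) g). *)
Lemma var_pow2_Sq_hit N c j (i : 'I_m) (v : 'X_{1..m}) :
  (forall s, N != 2 ^ s)%N -> (c + 2 ^ j = N)%N ->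
  'X_i ^+ (2 ^ j) * Sq c 'X_[v] \in hit_in (c + 2 ^ j + mdeg v).
Proof.
move=> N2; elim/ltn_ind: c j => c IH j cN.
have c0 : (0 < c)%N by case: c cN {IH} => // /eqP; rewrite add0n eq_sym (negbTE (N2 _)).
have E := Sq_var_pow2M c j i 'X_[v].
have H : Sq c ('X_i ^+ (2 ^ j) * 'X_[v]) \in hit_in (c + 2 ^ j + mdeg v).
  have -> : 'X_i ^+ (2 ^ j) * 'X_[v] = 'X_[U_(i) *+ (2 ^ j) + v] :> P.
    by rewrite mpolyXD mpolyXn.
  have -> : (c + 2 ^ j + mdeg v = c + mdeg (U_(i) *+ (2 ^ j) + v)%MM)%N.
    by rewrite mdegD mdegMn mdeg1 mul1n addnA.
  exact: Sq_hit_in.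
rewrite -[X in X \in _](addrK (if (2 ^ j <= c)%N
  then 'X_i ^+ (2 ^ j.+1) * Sq (c - 2 ^ j) 'X_[v] else 0)).
rewrite -E oppp rpredD //; case: leqP => [le|_]; last exact: rpred0.
have -> : (c + 2 ^ j = (c - 2 ^ j) + 2 ^ j.+1)%N by rewrite expnS; lia.
apply: IH; last by rewrite -cN expnS; lia.
by rewrite ltn_subrL c0 expn_gt0.
Qed.

Definition par_mnm (u : 'X_{1..m}) : 'X_{1..m} := [multinom odd (u i) : nat | i < m].
Definition half_mnm (u : 'X_{1..m}) : 'X_{1..m} := [multinom (u i)./2 | i < m].

Lemma mpolyX_par_half u : 'X_[u] = 'X_[par_mnm u] * 'X_[half_mnm u] ^+ 2 :> P.
Proof.
rewrite mpolyXn -mpolyXD; congr 'X_[_]; apply/mnmP => i.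
by rewrite mnmDE mulmnE !mnmE muln2 odd_double_half.
Qed.

Lemma mdeg_par_half u : mdeg u = (mdeg (par_mnm u) + 2 * mdeg (half_mnm u))%N.
Proof.
rewrite !mdegE big_distrr -big_split /=; apply: eq_bigr => i _.
by rewrite !mnmE mul2n odd_double_half.
Qed.

Lemma omega_mnm p t (u : 'X_{1..m}) : perm_eq p (enum 'I_m) ->
  omega t [seq u i | i <- p] = mdeg (par_mnm (iter t half_mnm u)).
Proof.
move=> pp; rewrite /omega count_map -sum1_count (perm_big _ pp) /= big_enum_cond /=.
rewrite mdegE big_mkcond /=; apply: eq_bigr => i _; rewrite mnmE.
suff -> : iter t half_mnm u i = (u i %/ 2 ^ t)%N by case: odd.
elim: t => [|t IH] /=; first by rewrite divn1.
by rewrite mnmE IH -divn2 -divnMA -expnSr.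
Qed.

Lemma nth_weight_mnm (u : 'X_{1..m}) t :
  nth 0%N (weight u) t = mdeg (par_mnm (iter t half_mnm u)).
Proof.
rewrite nth_weight -(omega_mnm t u (perm_refl _)) /omega count_map.
rewrite -sum1_count [RHS]big_enum_cond [RHS]big_mkcond /=.
by apply: eq_bigr => i _; case: odd.
Qed.

(** The gap of two reflects that the number of odd exponents has the parity of the degree, so it
    drops in even steps. *)
Definition low (r n : nat) : {pred P} := lspan (fun g => exists u : 'X_{1..m},
  [/\ mdeg u = n, (mdeg (par_mnm u) + 2 <= r)%N & g = 'X_[u]]).

HB.instance Definition _ r n := GRing.SubmodClosed.on (low r n).

(** On a squarefree monomial, Sq^j turns j of the exponents 1 into 2. *)
Lemma sq_mon_omega j e v : all (fun a => a <= 1)%N e -> v \in sq_mon j e ->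
  (omega 0 v + j = omega 0 e)%N.
Proof.
elim: e j v => [|a e IH] j v; first by case: j => //= _ /[!inE] /eqP ->.
move=> /andP[a1 e1]; rewrite [sq_mon _ _]/(flatten _) => /flattenP[s /mapP[i]].
rewrite mem_filter mem_iota => /andP[ai ij] -> /mapP[w /(IH _ _ e1) wE ->].
rewrite /omega /= !expn0 !divn1 -/(omega 0 w) -/(omega 0 e).
case: a a1 ai => [|[|a]] //= _; case: i ij wE => [|[|i]] //=; first by lia.
- by move=> _ <-; lia.
- by move=> ij <-; lia.
- by rewrite nth_default.
Qed.

(** For f = Sq^k(w), expand Sq^(2k)(X^e w^2). The term with Sq^0 on X^e is X^e f^2. Odd operations
    kill w^2, so every other term has a Sq^i on X^e with i even and positive, which removes at least
    two odd exponents. *)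
Lemma par_mulsqr_hit_in (e : 'X_{1..m}) n f : (forall i, e i <= 1)%N -> f \in hit_in n ->
  exists2 g, g \in hit_in (mdeg e + 2 * n) &
    'X_[e] * f ^+ 2 - g \in low (mdeg e) (mdeg e + 2 * n).
Proof.
move=> e1 /asboolP[l [c [v [Sv ->]]]].
have {}Sv i : exists g, g \in hit_in (mdeg e + 2 * n) /\
    'X_[e] * v i ^+ 2 - g \in low (mdeg e) (mdeg e + 2 * n).
  have [k [w [k0 <- ->]]] := Sv i; exists (Sq k.*2 ('X_[e] * 'X_[w] ^+ 2)); split.
    have -> : (mdeg e + 2 * (k + mdeg w) = k.*2 + mdeg (e + w *+ 2))%N.
      by rewrite mdegD mdegMn; lia.
    by rewrite mpolyXn -mpolyXD Sq_hit_in // double_gt0.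
  rewrite Sq_cartan big_ord_recl /= Sq0_id subn0 Sq_sqr odd_double doubleK.
  rewrite opprD addNKr -[X in X \in _]opprK oppp opprK rpred_sum // => j _.
  rewrite Sq_sqr /bump leq0n add1n; case: ifP => [_|oj]; first by rewrite mulr0 rpred0.
  set h := (_ - _)./2; have {}oj : (0 < j.+1 < k.*2.+1)%N && ~~ odd j.+1.
    by have jk := ltn_ord j; move: oj; rewrite oddB // odd_double /= ltnS jk => ->.
  pose p := enum 'I_m; have pp : perm_eq p (enum 'I_m) by [].
  rewrite -(pmonE e pp) -(pmonE w pp) !Sq_pmon ?size_map // sqrp_sum.
  rewrite mulr_suml big_seq rpred_sum // => a aE.
  rewrite mulr_sumr big_seq rpred_sum // => b /sq_monP[sb tb].
  have ae : (omega 0 a + j.+1 = mdeg e)%N.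
    rewrite (sq_mon_omega _ aE) ?(omega_mnm 0 e pp) /=.
      by congr mdeg; apply/mnmP => x; rewrite mnmE; case: (e x) (e1 x) => [|[|]].
    by apply/allP => _ /mapP[x _ ->].
  have [sa ta] := sq_monP aE; 
  have {}sa : size a = size p by rewrite sa (size_map e p).
  have {}sb : size b = size p by rewrite sb (size_map w p).
  have -> : pmon p a * pmon p b ^+ 2 = pmon p (addmul 1 a b).
    by rewrite pmon_addmul ?sa ?sb.
  have sab : size (addmul 1 a b) = m by rewrite size_addmul ?sa ?sb ?size_enum_ord.
  have [u uE ->] := pmon_mpolyX pp sab.
  apply: lspan_gen; exists u; split=> //.
    rewrite -(sumn_mnm u pp) uE sumn_addmul ?sa ?sb // ta tb !(sumn_mnm _ pp).
    by move: oj; rewrite /h; have := ltn_ord j; lia.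
  rewrite -[par_mnm u]/(par_mnm (iter 0 half_mnm u)) -(omega_mnm 0 u pp) uE.
  have : omegas 1 (addmul 1 a b) = omegas 1 a.
    by rewrite -omegas_mod mod_addmul ?sa ?sb // omegas_mod.
  by case=> ->; rewrite -ae; move: oj; lia.
pose g i := projT1 (cid (Sv i)).
have g_hit i : g i \in hit_in _ := (projT2 (cid (Sv i))).1.
have g_low i : _ - g i \in low _ _ := (projT2 (cid (Sv i))).2.
exists (\sum_(i < l) c i *: g i).
  by rewrite rpred_sum // => i _; rewrite rpredZ // g_hit.
rewrite sqrp_sum mulr_sumr -sumrB rpred_sum // => i _.
by rewrite exprZn F2_sqr -scalerAr -scalerBr rpredZ // g_low.
Qed.

(** In odd degree such a monomial has exactly one odd exponent, hence is x h^2 = x Sq^d(h) with h of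
    degree d; this is the case j = 0 of [var_pow2_Sq_hit]. *)
Lemma low3_hit_in d : (forall s, d.+1 != 2 ^ s)%N ->
  {subset low 3 (d.*2.+1) <= hit_in d.*2.+1}.
Proof.
move=> d2; apply: lspan_min => f [u [du pu ->]].
have {pu} pu : mdeg (par_mnm u) = 1%N by have := mdeg_par_half u; lia.
have hu : mdeg (half_mnm u) = d by have := mdeg_par_half u; lia.
have /mdeg1P[i /eqP pE] : mdeg (par_mnm u) == 1%N by rewrite pu.
have := @var_pow2_Sq_hit d.+1 d 0 i (half_mnm u) d2 (addn1 d).
have -> : Sq d 'X_[half_mnm u] = 'X_[half_mnm u] ^+ 2 :> P by rewrite -Sq_top hu.
rewrite (mpolyX_par_half u) pE expr1 hu.
by have -> : (d + 2 ^ 0 + d = d.*2.+1)%N by lia.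
Qed.

End HomogeneousHits.

Arguments hit_in m n _ : clear implicits.
Arguments low m r n _ : clear implicits.

(** * Monomials of degree 41 *)

(* The certificates were found by linear algebra outside of Rocq. *)
Definition cert_3_5 : seq (seq (nat * seq nat)) := [::
  [:: (1, [:: 3; 3; 3; 2; 1])]]%N.

Definition cert_3_3_4 : seq (seq (nat * seq nat)) := [::
  [:: (1, [:: 7; 7; 7; 3; 0])]; [:: (2, [:: 7; 7; 6; 3; 0])];
  [:: (2, [:: 7; 7; 6; 2; 1])]; [:: (2, [:: 7; 6; 6; 3; 1])];
  [:: (1, [:: 7; 7; 5; 4; 1])]; [:: (1, [:: 7; 6; 5; 5; 1])];
  [:: (2, [:: 7; 7; 4; 3; 2])]; [:: (2, [:: 7; 6; 5; 3; 2])];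
  [:: (1, [:: 3; 10; 3; 5; 3]); (4, [:: 3; 6; 3; 6; 3]);
      (1, [:: 3; 5; 3; 10; 3]); (2, [:: 5; 6; 3; 6; 3])]]%N.

Definition cert_3_3_2_3 : seq (seq (nat * seq nat)) := [::
  [:: (4, [:: 15; 15; 7; 0; 0])]; [:: (4, [:: 15; 15; 6; 1; 0])];
  [:: (4, [:: 15; 15; 5; 2; 0])]; [:: (4, [:: 15; 15; 4; 3; 0])];
  [:: (4, [:: 15; 15; 4; 2; 1])]; [:: (4, [:: 15; 14; 7; 1; 0])];
  [:: (4, [:: 15; 14; 6; 1; 1])]; [:: (4, [:: 15; 14; 5; 3; 0])];
  [:: (4, [:: 15; 14; 5; 2; 1])]; [:: (4, [:: 15; 14; 4; 3; 1])];
  [:: (4, [:: 15; 13; 7; 2; 0])]; [:: (4, [:: 15; 13; 6; 3; 0])];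
  [:: (4, [:: 15; 13; 6; 2; 1])]; [:: (4, [:: 15; 13; 5; 2; 2])];
  [:: (4, [:: 15; 13; 4; 3; 2])]; [:: (4, [:: 15; 12; 7; 3; 0])];
  [:: (4, [:: 15; 12; 7; 2; 1])]; [:: (4, [:: 15; 12; 6; 3; 1])];
  [:: (4, [:: 15; 12; 5; 3; 2])]; [:: (4, [:: 15; 12; 4; 3; 3])];
  [:: (4, [:: 14; 14; 7; 1; 1])]; [:: (4, [:: 14; 14; 5; 3; 1])];
  [:: (4, [:: 14; 13; 7; 3; 0])]; [:: (4, [:: 14; 13; 7; 2; 1])];
  [:: (4, [:: 14; 13; 6; 3; 1])]; [:: (4, [:: 14; 13; 5; 3; 2])];
  [:: (4, [:: 14; 13; 4; 3; 3])]; [:: (4, [:: 14; 12; 7; 3; 1])];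
  [:: (4, [:: 14; 12; 5; 3; 3])]; [:: (4, [:: 13; 13; 7; 2; 2])];
  [:: (4, [:: 13; 13; 6; 3; 2])]; [:: (4, [:: 13; 12; 7; 3; 2])];
  [:: (4, [:: 13; 12; 6; 3; 3])]; [:: (4, [:: 12; 12; 7; 3; 3])];
  [:: (1, [:: 15; 11; 11; 3; 0])]; [:: (2, [:: 15; 11; 10; 3; 0])];
  [:: (2, [:: 15; 11; 10; 2; 1])]; [:: (2, [:: 15; 10; 10; 3; 1])];
  [:: (2, [:: 14; 11; 11; 3; 0])]; [:: (2, [:: 14; 11; 11; 2; 1])];
  [:: (2, [:: 14; 11; 10; 3; 1])]; [:: (1, [:: 15; 11; 9; 5; 0])];
  [:: (1, [:: 15; 11; 9; 4; 1])]; [:: (1, [:: 13; 11; 11; 5; 0])];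
  [:: (1, [:: 13; 11; 11; 4; 1])]; [:: (4, [:: 15; 11; 7; 4; 0])];
  [:: (4, [:: 15; 11; 6; 4; 1])]; [:: (4, [:: 15; 10; 7; 5; 0])];
  [:: (4, [:: 15; 10; 7; 4; 1])]; [:: (4, [:: 15; 10; 6; 5; 1])];
  [:: (4, [:: 14; 11; 7; 5; 0])]; [:: (4, [:: 14; 11; 7; 4; 1])];
  [:: (4, [:: 14; 11; 6; 5; 1])]; [:: (4, [:: 14; 10; 7; 5; 1])];
  [:: (1, [:: 15; 11; 8; 5; 1])]; [:: (1, [:: 15; 10; 9; 5; 1])];
  [:: (1, [:: 15; 9; 9; 6; 1])]; [:: (1, [:: 15; 9; 8; 7; 1])];
  [:: (1, [:: 14; 11; 9; 5; 1])]; [:: (1, [:: 14; 9; 9; 7; 1])];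
  [:: (1, [:: 13; 11; 9; 7; 0])]; [:: (1, [:: 13; 11; 8; 7; 1])];
  [:: (2, [:: 11; 11; 11; 4; 2])]; [:: (2, [:: 15; 11; 8; 3; 2])];
  [:: (2, [:: 15; 10; 9; 3; 2])]; [:: (2, [:: 14; 11; 9; 3; 2])];
  [:: (2, [:: 11; 11; 10; 7; 0])]; [:: (2, [:: 11; 11; 8; 7; 2])];
  [:: (1, [:: 13; 11; 9; 4; 3])]; [:: (4, [:: 15; 10; 5; 4; 3])];
  [:: (4, [:: 15; 9; 6; 4; 3])]; [:: (4, [:: 15; 8; 7; 4; 3])];
  [:: (4, [:: 14; 11; 5; 4; 3])]; [:: (4, [:: 14; 9; 7; 4; 3])];
  [:: (4, [:: 11; 8; 7; 7; 4])]; [:: (1, [:: 13; 11; 8; 5; 3])];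
  [:: (1, [:: 13; 9; 8; 7; 3])]; [:: (2, [:: 13; 11; 10; 3; 2])];
  [:: (1, [:: 13; 11; 10; 5; 1])]; [:: (1, [:: 13; 11; 9; 5; 2])];
  [:: (2, [:: 11; 11; 8; 6; 3])]; [:: (4, [:: 13; 10; 7; 5; 2])];
  [:: (1, [:: 13; 10; 9; 7; 1])]; [:: (2, [:: 11; 11; 10; 6; 1])];
  [:: (2, [:: 11; 11; 9; 6; 2])]; [:: (1, [:: 12; 11; 11; 5; 1])];
  [:: (1, [:: 11; 11; 9; 5; 4])]; [:: (4, [:: 12; 11; 7; 6; 1])];
  [:: (1, [:: 12; 11; 9; 7; 1])]; [:: (2, [:: 12; 11; 11; 3; 2])];
  [:: (2, [:: 11; 10; 9; 7; 2])]; [:: (4, [:: 12; 11; 7; 4; 3])];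
  [:: (2, [:: 11; 10; 8; 7; 3])]; [:: (4, [:: 11; 9; 7; 6; 4])];
  [:: (4, [:: 10; 9; 7; 7; 4])];
  [:: (4, [:: 3; 3; 10; 11; 10]); (2, [:: 5; 3; 10; 11; 10]); (2, [:: 3; 5; 10; 11; 10])];
  [:: (4, [:: 7; 9; 3; 9; 9]); (2, [:: 13; 5; 3; 9; 9]); (1, [:: 11; 5; 6; 9; 9]);
     (1, [:: 11; 6; 5; 9; 9]); (2, [:: 7; 9; 5; 9; 9]); (4, [:: 11; 5; 3; 9; 9])];
  [:: (4, [:: 6; 7; 5; 10; 9]); (8, [:: 6; 7; 5; 6; 9]); (2, [:: 6; 7; 3; 6; 17]);
     (4, [:: 10; 7; 5; 6; 9])];
  [:: (1, [:: 10; 9; 9; 7; 5])]; [:: (4, [:: 10; 9; 7; 6; 5])];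
  [:: (4, [:: 5; 13; 3; 6; 10]); (2, [:: 9; 11; 3; 6; 10]); (4, [:: 5; 11; 3; 6; 12]);
     (2, [:: 5; 11; 3; 10; 10])];
  [:: (1, [:: 12; 11; 9; 5; 3])]; [:: (2, [:: 11; 10; 10; 5; 3])];
  [:: (4, [:: 12; 10; 7; 5; 3])]; [:: (2, [:: 11; 10; 9; 6; 3])];
  [:: (1, [:: 13; 10; 9; 5; 3])]; [:: (1, [:: 13; 9; 9; 6; 3])]]%N.

Lemma check_3_5 : check 5%N 2%N [:: 3; 5]%N [::] cert_3_5.
Proof. by vm_compute. Qed.

Lemma check_3_3_4 : check 5%N 3%N [:: 3; 3; 4]%N [::] cert_3_3_4.
Proof. by vm_compute. Qed.

Lemma check_3_3_2_3 : check 5%N 4%N [:: 3; 3; 2; 3]%N [::] cert_3_3_2_3.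
Proof. by vm_compute. Qed.

(** * Monomials of weight below (3,3,2,1,1) are hit *)

Section LowWeight.
Variable m : nat.
Local Notation P := {mpoly F2[m]}.

(** One step of the climb in degree: the error terms of [par_mulsqr_hit_in] have a single odd
    exponent and degree 2(n+1)+1, so [low3_hit_in] applies to them. *)
Lemma half_hit_in n (u : 'X_{1..m}) : mdeg (par_mnm u) = 3%N ->
  (forall s, n.+2 != 2 ^ s)%N -> 'X_[half_mnm u] \in hit_in m n ->
  'X_[u] \in hit_in m (3 + 2 * n).
Proof.
move=> u3 n2 fn; have [|g] := par_mulsqr_hit_in (e := par_mnm u) _ fn.
  by move=> i; rewrite mnmE leq_b1.
rewrite -mpolyX_par_half u3 => gh gl; rewrite -['X_[u]](subrK g) rpredD //.
have E : (3 + 2 * n = n.+1.*2.+1)%N by lia.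
by rewrite E in gl *; apply: low3_hit_in gl.
Qed.

(** Let [t] be the first index at which the weight is smaller. The successive halves of [u] have
    degrees 41, 19, 8, 3, 1 as long as the weights agree. By parity the smaller entry is 1 for t = 0
    or 1 and 0 for t = 2, where the half is a square of a monomial of degree 4; for t = 3 or 4
    parity is contradicted. *)
Lemma weight_lt_hit_in (u : 'X_{1..m}) : mdeg u = 41%N ->
  wlt (weight u) [:: 3; 3; 2; 1; 1]%N -> 'X_[u] \in hit_in m 41.
Proof.
(* These are the numbers that must not be powers of 2: 10 = 8 + 2 = 9 + 1 in degree 19, and 21 = 19
   + 2 = 20 + 1 in degree 41. *)
have n2 d : (d \in [:: 10; 21])%N -> forall s, (d != 2 ^ s)%N.
  move=> dE s; have [s5|s5] := ltnP s 5; last first.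
    have := leq_pexp2l (isT : 0 < 2)%N s5; move: dE; rewrite !inE; lia.
  by move: dE; rewrite !inE => /pred2P[] ->; case: s s5 => [|[|[|[|[|]]]]].
have hE := mdeg_par_half.
move=> u41 [t [eqw ltw]].
have {}eqw s : (s < t)%N ->
    mdeg (par_mnm (iter s (@half_mnm m) u)) = nth 0%N [:: 3; 3; 2; 1; 1]%N s.
  by rewrite -nth_weight_mnm; apply: eqw.
rewrite nth_weight_mnm in ltw.
have d0 := hE _ u; set u1 := half_mnm u in d0.
case: t eqw ltw => [_ /= u0|t eqw].
  apply: (@low3_hit_in m 20); first exact: (n2 21).
  by apply: lspan_gen; exists u; split=> //; lia.
have {}d0 : mdeg u1 = 19%N by have := eqw 0%N isT; rewrite /=; lia.
have uh f : f = 'X_[u1] -> f \in hit_in m 19 -> 'X_[u] \in hit_in m 41.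
  move=> ->; apply: (@half_hit_in 19 u (eqw 0%N isT)); exact: (n2 21).
have d1 := hE _ u1; set u2 := half_mnm u1 in d1.
case: t eqw => [_ /= u10|t eqw].
  apply: uh (erefl _) _; apply: (@low3_hit_in m 9); first exact: (n2 10).
  by apply: lspan_gen; exists u1; split=> //; rewrite -/u1 in u10; lia.
have {}d1 : mdeg u2 = 8%N by have := eqw 1%N isT; rewrite /= -/u1; lia.
have u1h f : f = 'X_[u2] -> f \in hit_in m 8 -> 'X_[u] \in hit_in m 41.
  move=> -> h8; apply: uh (erefl _) _.
  by apply: (@half_hit_in 8 u1 (eqw 1%N isT)) => //; apply: (n2 10).
have d2 := hE _ u2; set u3 := half_mnm u2 in d2.
case: t eqw => [_ /= u20|t eqw].
  have {}u20 : mdeg (par_mnm u2) = 0%N by rewrite -/u1 -/u2 in u20; lia.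
  apply: u1h (erefl _) _; have u34 : mdeg u3 = 4%N by lia.
  move/eqP: u20; rewrite mdeg_eq0 => /eqP u20.
  rewrite mpolyX_par_half u20 mpolyX0 mul1r -/u3 -Sq_top u34.
  by have := @Sq_hit_in m 4 u3 isT; rewrite u34.
have {}d2 : mdeg u3 = 3%N by have := eqw 2 isT; rewrite /= -/u1 -/u2; lia.
have d3 := hE _ u3; set u4 := half_mnm u3 in d3.
case: t eqw => [_ /=|t eqw]; first by rewrite -/u1 -/u2 -/u3; lia.
have {}d3 : mdeg u4 = 1%N by have := eqw 3 isT; rewrite /= -/u1 -/u2 -/u3; lia.
have d4 := hE _ u4; case: t eqw => [_ /=|t eqw].
  by rewrite -/u1 -/u2 -/u3 -/u4; lia.
by rewrite nth_default.
Qed.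

End LowWeight.

(** * Reduction to weight at most (3,3,2,1,1) *)

Definition w41 : seq nat := [:: 3; 3; 2; 1; 1]%N.

Lemma wdeg_w41 : wdeg w41 = 41%N.
Proof. by rewrite /wdeg !big_ord_recl big_ord0. Qed.

Definition hit_or_Ple : {pred {mpoly F2[5]}} := addsm (hit 5) (Ple 5 w41).

HB.instance Definition _ := GRing.SubmodClosed.on hit_or_Ple.

Lemma hit_hit_or_Ple : {subset hit 5 <= hit_or_Ple}.
Proof.
by move=> f fh; apply/asboolP; exists f, 0; split; rewrite ?addr0 // rpred0.
Qed.

Lemma omega_eq0 s t u : sumn [seq (a %/ 2 ^ s)%N | a <- u] = 0%N -> (s <= t)%N ->
  omega t u = 0%N.
Proof.
move=> + st; elim: u => //= a u IH /eqP; rewrite addn_eq0 => /andP[/eqP a0 /eqP /IH].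
by rewrite /omega /= => ->; rewrite -(subnKC st) expnD divnMA a0 div0n.
Qed.

(** If the first three entries are 3, 3, 2, the remaining degree 24 makes the fourth entry odd.
    Being below 3 it is 1, which leaves exactly one exponent digit of value 16. *)
Lemma all_in_le u : size u = 5%N -> sumn u = 41%N ->
  lexlt (omegas 4 u) [:: 3; 3; 2; 3]%N -> all_in hit_or_Ple u.
Proof.
move=> su u41 ult p pp; have [v vE ->] := pmon_mpolyX pp su.
apply/asboolP; exists 0, 'X_[v]; split; rewrite ?add0r ?rpred0 //.
apply: lspan_gen; exists v; split=> //.
  by rewrite -(sumn_mnm v pp) vE u41 wdeg_w41.
have wE t : nth 0%N (weight v) t = omega t u.
  by rewrite nth_weight_mnm -(omega_mnm t v pp) vE.
have [h1 h2 h3 h4] := And4 (sumn_omegas 1 u) (sumn_omegas 2 u)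
    (sumn_omegas 3 u) (sumn_omegas 4 u).
have h5 := sumn_omegas 5 u; rewrite u41 /omegas /= in h1 h2 h3 h4 h5 ult.
have [l0|g0] := ltnP (omega 0 u) 3.
  by left; exists 0%N; rewrite wE.
have [l1|g1] := ltnP (omega 1 u) 3.
  by left; exists 1%N; split=> [[|//] _|]; rewrite wE //=; lia.
have [l2|g2] := ltnP (omega 2 u) 2.
  by left; exists 2; split=> [[|[|//]] _|]; rewrite wE //=; lia.
right=> t; rewrite wE; have [|t5] := ltnP t 5.
  by case: t => [|[|[|[|[|]]]]] //= _; lia.
by rewrite nth_default // (omega_eq0 _ t5) //; lia.
Qed.

(** The three certificates are applied in increasing order of weight, each using the previous
    conclusion for lower weights. Parity of the degree and the bound of five variables show that
    between consecutive thresholds only the prefixes (3,3,2,3), (3,3,4) and (3,5) occur. *)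
Lemma all_in_omega0_le3 u : size u = 5%N -> sumn u = 41%N -> (omega 0 u <= 3)%N ->
  all_in hit_or_Ple u.
Proof.
have H3323 := check_sound hit_hit_or_Ple all_in_le check_3_3_2_3.
have H334 : forall u, size u = 5%N -> sumn u = 41%N ->
    lexlt (omegas 3 u) [:: 3; 3; 4]%N -> all_in hit_or_Ple u.
  move=> {}u su u41; rewrite /omegas /= => ult.
  have [lt|ge] := boolP (lexlt (omegas 4 u) [:: 3; 3; 2; 3]%N).
    exact: all_in_le su u41 lt.
  apply: (H3323 u su u41); move: ge; rewrite /omegas /= => ge.
  have [h1 h2 h3 h4] := And4 (sumn_omegas 1 u) (sumn_omegas 2 u)
    (sumn_omegas 3 u) (sumn_omegas 4 u).
  rewrite u41 /omegas /= in h1 h2 h3 h4.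
  by congr [:: _; _; _; _]; lia.
have om5 t v : size v = 5%N -> (omega t v <= 5)%N by move=> <-; apply: count_size.
have H35 : forall u, size u = 5%N -> sumn u = 41%N ->
    lexlt (omegas 2 u) [:: 3; 5]%N -> all_in hit_or_Ple u.
  move=> {}u su u41; rewrite /omegas /= => ult.
  have [lt|ge] := boolP (lexlt (omegas 3 u) [:: 3; 3; 4]%N).
    exact: H334 su u41 lt.
  apply: (check_sound hit_hit_or_Ple H334 check_3_3_4 su u41).
  move: ge; rewrite /omegas /= => ge; have o5 := om5 2%N u su.
  have [h1 h2 h3] := And3 (sumn_omegas 1 u) (sumn_omegas 2 u) (sumn_omegas 3 u).
  rewrite u41 /omegas /= in h1 h2 h3.
  by congr [:: _; _; _]; lia.
move=> su u41 u3.
have [lt|ge] := boolP (lexlt (omegas 2 u) [:: 3; 5]%N).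
  exact: H35 su u41 lt.
apply: (check_sound hit_hit_or_Ple H35 check_3_5 su u41).
move: ge; rewrite /omegas /= => ge; have o5 := om5 1%N u su.
have [h1 h2] := conj (sumn_omegas 1 u) (sumn_omegas 2 u).
rewrite u41 /omegas /= in h1 h2.
by congr [:: _; _]; lia.
Qed.

Lemma par_le3_hit_or_Ple (u : 'X_{1..5}) : mdeg u = 41%N ->
  (mdeg (par_mnm u) <= 3)%N -> 'X_[u] \in hit_or_Ple.
Proof.
move=> u41 u3; have pp := perm_refl (enum 'I_5); rewrite -(pmonE u pp).
apply: all_in_omega0_le3 => //.
- by rewrite size_map size_enum_ord.
- by rewrite sumn_mnm.
- by rewrite (omega_mnm 0 u pp).
Qed.

(** Subtracting x_1...x_5 times the square of [kameko_poly f] cancels the monomials of [f] whose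
    exponents are all odd. The subtracted product is a hit plus monomials with at most three odd
    exponents. *)
Lemma kameko_hit_or_Ple (f : {mpoly F2[5]}) : f \in homdeg 5 41 ->
  kameko_poly f \in hit 5 -> f \in hit_or_Ple.
Proof.
move=> f41 kf; pose e : 'X_{1..5} := [multinom 1%N | i < 5].
have e1 i : (e i <= 1)%N by rewrite mnmE.
have e5 : mdeg e = 5%N.
  rewrite mdegE (eq_bigr (fun=> 1%N)) ?sum1_card ?card_ord // => i.
  by rewrite mnmE.
have kf18 : kameko_poly f \in hit_in 5 18.
  by apply: hit_hit_in => //; apply: (@kameko_poly_deg 5 18).
have [g gh gl] := par_mulsqr_hit_in e1 kf18; rewrite e5 in gh gl.
have low5 : {subset low 5 5 41 <= hit_or_Ple}.
  apply: lspan_min => _ [u [u41 u5 ->]]; apply: par_le3_hit_or_Ple => //; lia.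
rewrite -[f](subrK ('X_[e] * kameko_poly f ^+ 2)) rpredD //; last first.
  rewrite -[_ * _](subrK g) rpredD //; first exact: low5 gl.
  by apply: hit_hit_or_Ple; apply: hit_in_hit gh.
rewrite /kameko_poly sqrp_sum mulr_sumr {1}[f]mpolyE -sumrB big_seq rpred_sum // => u uf.
rewrite exprZn F2_sqr -scalerAr -scalerBr rpredZ // /kameko_mon.
have u41 : mdeg u = 41%N by move/dhomogP: f41 => /(_ u uf).
case: forallP => [uo|ue].
  have -> : 'X_[u] = 'X_[e] * 'X_[kameko_half u] ^+ 2 :> {mpoly F2[5]}.
    rewrite mpolyXn -mpolyXD; congr 'X_[_]; apply/mnmP => i.
    by rewrite mnmDE mulmnE !mnmE; have := uo i; lia.
  by rewrite subrr rpred0.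
rewrite expr0n mulr0 subr0; apply: par_le3_hit_or_Ple => //.
have := mdeg_par_half u.
(* In degree 41 the number of odd exponents is odd, so once it is not 5 it is at most 3. *)
suff : mdeg (par_mnm u) != 5%N /\ (mdeg (par_mnm u) <= 5)%N by lia.
have pe i : true -> (par_mnm u i <= e i ?= iff odd (u i))%N.
  by move=> _; rewrite !mnmE; split; rewrite ?leq_b1 //; case: odd.
have := leqif_sum pe; rewrite -!mdegE e5 => -[-> E]; split=> //.
by apply/negP; rewrite E => /forallP uo; apply: ue.
Qed.

(** * The splitting into P^0 and P^(>0) *)

Section Restriction.
Variable m : nat.
Local Notation P := {mpoly F2[m]}.

Definition mrestr (A : pred 'X_{1..m}) (f : P) : P :=
  \sum_(u <- msupp f | A u) f@_u *: 'X_[u].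

Lemma mcoeff_mrestr A f u : (mrestr A f)@_u = if A u then f@_u else 0.
Proof.
rewrite raddf_sum /= big_mkcond /=.
rewrite (eq_bigr (fun v => if A v then f@_v * (v == u)%:R else 0)) => [|v _]; last first.
  by case: ifP => // _; rewrite mcoeffZ mcoeffX.
have [fu|fu] := boolP (u \in msupp f).
  rewrite (bigD1_seq u) //= eqxx mulr1 big1 ?addr0 // => v /negbTE->.
  by rewrite mulr0 if_same.
rewrite big_seq big1 => [|v vf]; first by rewrite (memN_msupp_eq0 fu) if_same.
have /negbTE-> : v != u by apply: contraNneq fu => <-.
by rewrite mulr0 if_same.
Qed.

Lemma mrestr_linear A : linear (mrestr A).
Proof.
move=> c f g; apply/mpolyP => u.
rewrite mcoeffD mcoeffZ !mcoeff_mrestr mcoeffD mcoeffZ.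
by case: ifP => // _; rewrite mulr0 addr0.
Qed.

HB.instance Definition _ A :=
  GRing.isLinear.Build F2 P P _ (mrestr A) (mrestr_linear A).

Lemma mrestrX A u : mrestr A 'X_[u] = if A u then 'X_[u] else 0.
Proof.
apply/mpolyP => v; rewrite mcoeff_mrestr [in RHS]fun_if mcoeffX mcoeff0.
by case: eqP => [->|_]; rewrite ?if_same //; case: ifP.
Qed.

Lemma mrestr_lspan (A : pred 'X_{1..m}) (S T : P -> Prop) f :
  (forall g, S g -> exists2 u, g = 'X_[u] & A u -> T 'X_[u]) ->
  f \in lspan S -> mrestr A f \in lspan T.
Proof.
move=> ST /asboolP[k [c [v [Sv ->]]]]; rewrite raddf_sum rpred_sum //= => i _.
rewrite linearZ rpredZ //=; have [u -> Tu] := ST _ (Sv i).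
by rewrite mrestrX; case: ifP => [/Tu|_]; [apply: lspan_gen | rewrite rpred0].
Qed.

Lemma mrestr_id (A : pred 'X_{1..m}) (S : P -> Prop) f :
  (forall g, S g -> exists2 u, g = 'X_[u] & A u) ->
  f \in lspan S -> mrestr A f = f.
Proof.
move=> SA /asboolP[k [c [v [Sv ->]]]]; rewrite raddf_sum /=.
apply: eq_bigr => i _; rewrite linearZ /=.
by have [u -> Au] := SA _ (Sv i); rewrite mrestrX Au.
Qed.

Lemma linear_mpolyX_eq (phi psi : {linear P -> P}) :
  (forall u, phi 'X_[u] = psi 'X_[u]) -> phi =1 psi.
Proof.
move=> E f; rewrite [f]mpolyE !linear_sum; apply: eq_bigr => u _.
by rewrite !linearZ E.
Qed.

Definition has0 (u : 'X_{1..m}) : bool := (\prod_j u j == 0)%N.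

(** The value [true] gives the projection to P^0 and [false] the one to P^(>0). *)
Definition part (b : bool) : P -> P := mrestr (fun u => has0 u == b).

HB.instance Definition _ b := GRing.Linear.on (part b).

Lemma part_split f : part true f + part false f = f.
Proof.
apply/mpolyP => u; rewrite mcoeffD !mcoeff_mrestr.
by case: (has0 u); rewrite ?addr0 ?add0r.
Qed.

(** Positive squares kill x^0 = 1 and exponents never decrease. This is why both summands are stable
    under the Steenrod algebra. *)
Lemma sq_mon_has0 k u v : v \in sq_mon k u -> (0%N \in v) = (0%N \in u).
Proof.
elim: u k v => [|a u IH] k v; first by case: k => //= /[!inE] /eqP ->.
rewrite [sq_mon _ _]/(flatten _) => /flattenP[s /mapP[i]].
rewrite mem_filter => /andP[ai _] -> /mapP[w /IH wE ->].
rewrite !inE wE; congr (_ || _); case: a ai => //=.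
by case: i => // i; rewrite nth_default.
Qed.

Lemma has0E p (u : 'X_{1..m}) : perm_eq p (enum 'I_m) ->
  has0 u = (0%N \in [seq u i | i <- p]).
Proof.
move=> pp; rewrite /has0 -big_enum -(perm_big _ pp) /=.
elim: p {pp} => [|i p IH]; first by rewrite big_nil.
by rewrite big_cons muln_eq0 IH map_cons in_cons eq_sym.
Qed.

Lemma part_Sq (b : bool) k f :
  part b (Sq k f) = Sq k (part b f).
Proof.
pose A (u : 'X_{1..m}) := has0 u == b; rewrite /part -/A.
have pp := perm_refl (enum 'I_m).
have AX u : mrestr A (Sq k 'X_[u]) = Sq k (mrestr A 'X_[u]).
  have SqX : Sq k 'X_[u] =
      \sum_(v <- sq_mon k [seq u i | i <- enum 'I_m]) pmon (enum 'I_m) v.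
    by rewrite -(pmonE u pp) Sq_pmon // (size_map u).
  rewrite mrestrX [in LHS]SqX raddf_sum /=.
  rewrite (eq_big_seq (fun v => if A u then pmon (enum 'I_m) v else 0)); last first.
    move=> v vu; have [sv _] := sq_monP vu; rewrite (size_map u) size_enum_ord in sv.
    have [w wv ->] := pmon_mpolyX pp sv.
    by rewrite mrestrX /A !(has0E _ pp) wv (sq_mon_has0 vu).
  by case: (A u); [rewrite SqX | rewrite big1 // raddf0].
pose phi : {linear P -> P} := mrestr A \o Sq k.
pose psi : {linear P -> P} := Sq k \o mrestr A.
exact: (@linear_mpolyX_eq phi psi AX f).
Qed.

Lemma part_Sq_word (b : bool) I f :
  part b (Sq_word I f) = Sq_word I (part b f).
Proof. by elim: I => //= k I <-; rewrite part_Sq. Qed.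

(** With [M] equal to [P0], a hit projects to a hit formed inside P^0; with [predT], each component
    of a hit is again a hit. *)
Lemma part_Abar b (M : {pred P}) f :
  (forall g, part b g \in M) -> f \in hit m -> part b f \in Abar M.
Proof.
move=> pM /asboolP[k [c [v [Sv ->]]]]; rewrite linear_sum rpred_sum //= => i _.
rewrite linearZ rpredZ //=; have [I [g [I0 _ ->]]] := Sv i.
by rewrite part_Sq_word; apply: lspan_gen; exists I, (part b g).
Qed.

Lemma part_P0 f : part true f \in P0 m.
Proof.
rewrite rpred_sum // => u /eqP/eqP u0; rewrite rpredZ //; apply: lspan_gen.
by exists u.
Qed.

Lemma P0_part f : f \in P0 m -> part true f = f.
Proof. by apply: mrestr_id => _ [u u0 ->]; exists u; rewrite // /has0 u0. Qed.

Lemma Ppos_part f : f \in Ppos m -> part false f = f.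
Proof.
by apply: mrestr_id => _ [u u0 ->]; exists u; rewrite // /has0 gtn_eqF.
Qed.

Lemma Abar_P0_hit : {subset Abar (P0 m) <= hit m}.
Proof.
by apply: lspan_min => _ [I [g [I0 _ ->]]]; apply: lspan_gen; exists I, g.
Qed.

Lemma kameko_poly_P0 f : f \in P0 m -> kameko_poly f = 0.
Proof.
move=> /asboolP[k [c [v [Sv ->]]]]; rewrite linear_sum big1 //= => i _.
rewrite kameko_polyZ; have [u u0 ->] := Sv i; rewrite kameko_polyX /kameko_mon.
case: forallP => [uo|_]; last by rewrite scaler0.
by have := @prodn_gt0 _ (index_enum 'I_m) xpredT u (fun j => odd_gt0 (uo j)); rewrite u0.
Qed.

End Restriction.

(** A linear correspondence, total on both sides, is the graph of an isomorphism once 0 is related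
    only to 0. Maps between quotients can thus be given through representatives, without a separate
    proof of well-definedness. *)
Lemma lmod_iso_rel (R : nzRingType) (V W : lmodType R) (r : V -> W -> Prop) :
  (forall v, exists w, r v w) -> (forall w, exists v, r v w) ->
  (forall a v v' w w', r v w -> r v' w' -> r (a *: v + v') (a *: w + w')) ->
  (forall w, r 0 w -> w = 0) -> (forall v, r v 0 -> v = 0) -> lmod_iso V W.
Proof.
move=> totV totW rlin r0w rv0.
have rB v v' w w' : r v w -> r v' w' -> r (v - v') (w - w').
  by move=> h h'; rewrite -2!scaleN1r 2![_ + -1 *: _]addrC; apply: rlin.
pose f v := projT1 (cid (totV v)); pose g w := projT1 (cid (totW w)).
have rf v : r v (f v) := projT2 (cid (totV v)).
have rg w : r (g w) w := projT2 (cid (totW w)).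
have fE v w : r v w -> f v = w.
  by move=> vw; apply/subr0_eq/r0w; rewrite -(subrr v); apply: rB.
have gE v w : r v w -> g w = v.
  by move=> vw; apply/subr0_eq/rv0; rewrite -(subrr w); apply: rB.
have flin : linear f by move=> a v v'; apply: fE; apply: rlin.
pose fL := GRing.isLinear.Build R V W _ f flin.
pose F : {linear V -> W} := HB.pack f fL.
by exists F; exists g => [v|w]; [apply: gE | apply: fE].
Qed.

(** * Polynomial representatives of the weight summand *)

Definition Pwpos : {pred {mpoly F2[5]}} := lspan (fun f => exists u : 'X_{1..5},
  [/\ 'X_[u] \in Ple 5 w41, 'X_[u] \in Ppos 5 & f = 'X_[u]]).

HB.instance Definition _ := GRing.SubmodClosed.on Pwpos.

Lemma Pwpos_Ple : {subset Pwpos <= Ple 5 w41}.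
Proof. by apply: lspan_min => _ [u [uP _ ->]]. Qed.

Lemma Pwpos_Ppos : {subset Pwpos <= Ppos 5}.
Proof. by apply: lspan_min => _ [u [_ uP ->]]. Qed.

Lemma Ple_homdeg : {subset Ple 5 w41 <= homdeg 5 41}.
Proof.
apply: lspan_min => _ [u [du _ ->]]; rewrite unfold_in dhomogX; apply/eqP.
by rewrite -wdeg_w41 -du.
Qed.

Lemma part_Ple b f : f \in Ple 5 w41 -> part b f \in Ple 5 w41.
Proof. by apply: mrestr_lspan => _ [u [du wu ->]]; exists u => // _; exists u. Qed.

Lemma part_Pwpos f : f \in Ple 5 w41 -> part false f \in Pwpos.
Proof.
apply: mrestr_lspan => _ [u [du wu ->]]; exists u => // /eqP u0; exists u; split=> //.
  by apply: lspan_gen; exists u.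
by apply: lspan_gen; exists u => //; rewrite lt0n; move: u0; rewrite /has0 => ->.
Qed.

(** A monomial of weight at most (3,3,2,1,1) has at most three odd exponents among five. *)
Lemma kameko_poly_Ple f : f \in Ple 5 w41 -> kameko_poly f = 0.
Proof.
move=> /asboolP[k [c [v [Sv ->]]]]; rewrite linear_sum big1 //= => i _.
rewrite kameko_polyZ; have [u [_ wu ->]] := Sv i; rewrite kameko_polyX /kameko_mon.
case: forallP => [uo|_]; last by rewrite scaler0.
have w0 : (nth 0%N (weight u) 0 <= 3)%N.
  case: wu => [[[|t] [eqw ltw]]|->] //; first exact: ltnW ltw.
  by rewrite eqw.
move: w0; rewrite nth_weight (eq_bigr (fun=> 1%N)) ?sum1_card ?card_ord // => j _.
by rewrite divn1 uo.
Qed.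

Lemma Plt_hit : {subset Plt 5 w41 <= hit 5}.
Proof.
apply: lspan_min => _ [u [du wu ->]]; apply: (@hit_in_hit _ 41).
by apply: weight_lt_hit_in; rewrite // du wdeg_w41.
Qed.

(** As the monomials of smaller weight are hit, passing to the weight quotient imposes no relation
    that does not hold in Q already. *)
Lemma Qw_rel_hit : {subset Qw_rel 5 w41 <= hit 5}.
Proof. by move=> _ /asboolP[g [h [/andP[gh _] /Plt_hit hh ->]]]; rewrite rpredD. Qed.

(** * The isomorphism *)

Local Notation Ker41 := (submodule
  (kernel (kameko 5 18 : {linear Qdeg 5 (5 + 2 * 18) -> Qdeg 5 18}))).
Local Notation Target41 := (Q0deg 5 41 * submodule (Qw_pos 5 w41))%type.

Definition ker41_rel (k : Ker41) (z : Target41) : Prop := exists f0 f1,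
  [/\ f0 \in capsm (P0 5) (homdeg 5 41), f1 \in Pwpos,
      val (val k) = cls (hit 5) (f0 + f1),
      val z.1 = cls (Abar (P0 5)) f0 & val (val z.2) = cls (Qw_rel 5 w41) f1].

Lemma cls_eq0 (R : nzRingType) (V : lmodType R) (B : submodClosed V) f :
  cls B f = 0 <-> f \in B.
Proof. by rewrite -(raddf0 (cls B)) cls_eq subr0. Qed.

Definition in_submodule (R : nzRingType) (V : lmodType R) (A : submodClosed V) f
  (fA : f \in A) : submodule A := exist (fun g => g \in A) f fA.

Lemma val_linear (R : nzRingType) (V : lmodType R) (A : submodClosed V) a
    (x y : submodule A) : val (a *: x + y) = a *: val x + val y.
Proof. exact: linearP. Qed.

Lemma cls_linear (R : nzRingType) (V : lmodType R) (B : submodClosed V) a f g :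
  cls B (a *: f + g) = a *: cls B f + cls B g.
Proof. exact: linearP. Qed.

Lemma ker41_rel_linear a k k' z z' :
  ker41_rel k z -> ker41_rel k' z' -> ker41_rel (a *: k + k') (a *: z + z').
Proof.
case=> f0 [f1 [f0P f1P kE z1E z2E]].
case=> g0 [g1 [g0P g1P kE' z1E' z2E']].
exists (a *: f0 + g0), (a *: f1 + g1); split.
- by rewrite rpredD ?rpredZ.
- by rewrite rpredD ?rpredZ.
- rewrite (val_linear a k k') (val_linear a (val k)) kE kE' -cls_linear.
  by rewrite scalerDr addrACA.
- by rewrite [LHS](val_linear a z.1) z1E z1E' cls_linear.
- have -> : (a *: z + z').2 = a *: z.2 + z'.2 by [].
  by rewrite (val_linear a z.2) (val_linear a (val z.2)) z2E z2E' cls_linear.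
Qed.

(** The sum [f0 + f1] is hit, and its components in P^0 and P^(>0) are [f0] and [f1]; each is
    therefore a hit, the first one inside P^0. *)
Lemma ker41_rel_0l z : ker41_rel 0 z -> z = 0.
Proof.
case: z => x y [f0 [f1 [/andP[f0P _] f1P kE xE yE]]].
have /cls_eq0 f01 : cls (hit 5) (f0 + f1) = 0 by rewrite -kE.
have p0 : part true (f0 + f1) = f0.
  rewrite raddfD /= (P0_part f0P) -[RHS]addr0; congr (_ + _).
  by apply: (addIr (part false f1)); rewrite part_split add0r Ppos_part // Pwpos_Ppos.
have p1 : part false (f0 + f1) = f1.
  by apply: (addrI (part true (f0 + f1))); rewrite part_split p0.
congr (_, _); apply: val_inj => /=.
  by rewrite xE; apply/cls_eq0; rewrite -p0; apply: part_Abar f01; apply: part_P0.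
apply: val_inj; rewrite /= yE; apply/cls_eq0/asboolP; exists f1, 0.
rewrite addr0 rpred0; split=> //; apply/andP; split; last exact: Pwpos_Ple.
by rewrite -p1; apply: part_Abar f01.
Qed.

Lemma ker41_rel_0r k : ker41_rel k 0 -> k = 0.
Proof.
move=> [f0 [f1 [_ _ kE /esym/cls_eq0 f0h /esym/cls_eq0 f1h]]].
apply/val_inj/val_inj; rewrite /= kE; apply/cls_eq0.
by apply: rpredD; [exact: Abar_P0_hit | exact: Qw_rel_hit].
Qed.

Lemma Pwpos_Qw_pos f : f \in Pwpos ->
  exists y : submodule (Qw_pos 5 w41), val (val y) = cls (Qw_rel 5 w41) f.
Proof.
move=> /asboolP[k [c [v [Sv ->]]]].
have vP i : v i \in Ple 5 w41 by have [u [uP _ ->]] := Sv i.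
pose q i : Qw 5 w41 := in_submodule (subquot_cls (Qw_rel 5 w41) (vP i)).
have qP : \sum_(i < k) c i *: q i \in Qw_pos 5 w41.
  rewrite rpred_sum // => i _; rewrite rpredZ //; apply: lspan_gen.
  by have [u [uP up vE]] := Sv i; exists u; split; rewrite //= vE.
pose y : submodule (Qw_pos 5 w41) := in_submodule qP.
have yE : val y = \sum_(i < k) c i *: q i by [].
exists y; rewrite yE !raddf_sum; apply: eq_bigr => i _ /=.
by rewrite linearZ.
Qed.

Lemma Qw_pos_Pwpos (y : submodule (Qw_pos 5 w41)) :
  exists2 f, f \in Pwpos & val (val y) = cls (Qw_rel 5 w41) f.
Proof.
have /asboolP[k [c [v [Sv yE]]]] := valP y.
have {}Sv i : exists f, f \in Pwpos /\ val (v i) = cls (Qw_rel 5 w41) f.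
  have [u [uP up vE]] := Sv i; exists 'X_[u]; split=> //.
  by apply: lspan_gen; exists u.
pose f i := projT1 (cid (Sv i)).
have fP i : f i \in Pwpos /\ _ := projT2 (cid (Sv i)).
exists (\sum_(i < k) c i *: f i).
  by rewrite rpred_sum // => i _; rewrite rpredZ // (fP i).1.
rewrite yE !raddf_sum; apply: eq_bigr => i _ /=.
by rewrite !linearZ /= (fP i).2.
Qed.

(** A representative of the class is a hit plus some [h] of weight at most (3,3,2,1,1); the two
    components of [h] give the pair. *)
Lemma ker41_rel_total k : exists z, ker41_rel k z.
Proof.
have /asboolP[f f41 kE] := valP (val k).
have kf : kameko_poly f \in hit 5.
  apply/cls_eq0; rewrite -kameko_quot_cls -kE.
  by have /eqP/(congr1 val) := valP k.
have /asboolP[g [h [gh hP fE]]] := kameko_hit_or_Ple f41 kf.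
have [y yE] := Pwpos_Qw_pos (part_Pwpos hP).
have h0P : part true h \in capsm (P0 5) (homdeg 5 41).
  by apply/andP; split; [exact: part_P0 | apply: Ple_homdeg; apply: part_Ple].
pose x : Q0deg 5 41 := in_submodule (subquot_cls (Abar (P0 5)) h0P).
exists (x, y), (part true h), (part false h); split=> //; first exact: part_Pwpos.
by rewrite kE part_split; apply/cls_eq; rewrite fE addrK.
Qed.

Lemma ker41_rel_surj z : exists k, ker41_rel k z.
Proof.
case: z => x y; have /asboolP[f0 f0P xE] := valP x.
have [f1 f1P yE] := Qw_pos_Pwpos y.
have f41 : f0 + f1 \in homdeg 5 (5 + 2 * 18).
  by rewrite rpredD //; [case/andP: f0P | apply: Ple_homdeg; apply: Pwpos_Ple].
pose q : Qdeg 5 (5 + 2 * 18) := in_submodule (subquot_cls (hit 5) f41).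
have qk : q \in kernel (kameko 5 18 : {linear Qdeg 5 (5 + 2 * 18) -> Qdeg 5 18}).
  (* Kameko's map kills both representatives already as polynomials. *)
  apply/eqP/val_inj; rewrite /= kameko_quot_cls raddfD /=.
  have /andP[f00 _] := f0P.
  by rewrite kameko_poly_P0 // kameko_poly_Ple ?Pwpos_Ple // addr0 raddf0.
by exists (in_submodule qk), f0, f1.
Qed.

Local Close Scope ring_scope.

Theorem theorem2p2 :
  let n1 := (5 * (2 ^ 1 - 1) + 18 * 2 ^ 1)%N in
  let w := [:: 3; 3; 2; 1; 1]%N in
  [/\ n1 = 41, n1 = (5 + 2 * 18)%N, wdeg w = 41 &
    lmod_iso
      (submodule
         (kernel (kameko 5 18 : {linear Qdeg 5 (5 + 2 * 18) -> Qdeg 5 18})))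
      (Q0deg 5 41 * submodule (Qw_pos 5 w))%type].
Proof.
split=> //; first exact: wdeg_w41.
apply: (lmod_iso_rel ker41_rel_total ker41_rel_surj ker41_rel_linear).
  exact: ker41_rel_0l.
exact: ker41_rel_0r.
Qed.
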